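(* Any realization of the two-dimensional noncommutative Lie algebra by vector fields on the circle $S^1$ (with vector fields from the class $\mathcal{C}$) is equivalent to a realization of the form $$\left\langle \sigma_k(\theta)\,(1-\cos(n\theta))\frac{d}{d\theta},\ \left(\frac1n\sin(n\theta)+\lambda_k(\theta)\,(1-\cos(n\theta))\right)\frac{d}{d\theta}\right\rangle$$ for some integer $n\ge 1$, where, for each $k=0,1,\dots,n-1$, $\lambda_k(\theta)\in\mathbb{R}$ and $\sigma_k(\theta)\in\{1,-1\}$ are constants on the interval $\left(\frac{2\pi k}{n},\frac{2\pi(k+1)}{n}\right)$ (the constants may differ from one interval to another).
   Context: The circle $S^1$ is parametrized by $\theta\in[0,2\pi)$. A vector field on $S^1$ is $v(\theta)\frac{d}{d\theta}$ with $v$ a real $2\pi$-periodic function; vector fields are of class $C^1$ (i.e. $v$ is continuously differentiable). The commutator is $\left[v\frac{d}{d\theta},w\frac{d}{d\theta}\right]=(vw'-v'w)\frac{d}{d\theta}$. A singular point of $v\frac{d}{d\theta}$ is a zero of $v$. The class $\mathcal{C}$ consists of the $C^1$ vector fields on $S^1$ whose set of singular points contains no nonempty open interval. A realization of the two-dimensional noncommutative algebra is a two-dimensional noncommutative Lie algebra of vector fields $\langle W,V\rangle$ with nonzero elements in $\mathcal{C}$; up to linear combinations, the generators satisfy $[V,W]=W$. An equivalence transformation is a map $f:S^1\to S^1$ such that: (i) $f$ is a one-to-one mapping of the circle onto itself; (ii) $f$ is continuous at every point; (iii) $f$ is continuously differentiable at all points except a finite number of them; (iv) $f'(\theta)$ tends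 to $-\infty$ or $+\infty$ at all points of discontinuity of $f'$; (v) under the change of coordinate $\tilde\theta=f(\theta)$ the $C^1$ vector fields to which the transformation is applied are transformed into vector fields of class $C^1$. Here $w(\theta)\frac{d}{d\theta}$ is transformed into $\tilde w(\tilde\theta)\frac{d}{d\tilde\theta}$ with $\tilde w(f(\theta))=w(\theta)f'(\theta)$ (at the finitely many exceptional points $\tilde w$ is determined by continuity). Rotations of the circle are included among these transformations. Two realizations are equivalent if one can be transformed to the other by a composition of equivalence transformations. *)

(* Defs.v *)
(* Stdlib reals with Coquelicot. *)
From Stdlib Require Export Reals List Relations.
From Coquelicot Require Export Coquelicot.
Open Scope R_scope.

Definition eq_mod_2pi (x y : R) : Prop := exists z : Z, x = y + IZR z * (2 * PI).

Definition C1_at (f : R -> R) (x : R) : Prop :=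
  locally x (fun y => ex_derive f y) /\ continuous (Derive f) x.

Definition periodic_2pi (v : R -> R) : Prop := forall t, v (t + 2 * PI) = v t.

(* The function v stands for the field v(theta) d/dtheta on the circle. *)
Definition vector_field (v : R -> R) : Prop :=
  periodic_2pi v /\ forall t, C1_at v t.

Definition bracket (v w : R -> R) : R -> R :=
  fun t => v t * Derive w t - Derive v t * w t.

Definition classC (v : R -> R) : Prop :=
  vector_field v /\
  ~ (exists a b, a < b /\ forall t, a < t < b -> v t = 0).

Definition span2 (W V : R -> R) : (R -> R) -> Prop :=
  fun u => exists a b : R, forall t, u t = a * W t + b * V t.

Definition independent2 (W V : R -> R) : Prop :=
  forall a b : R, (forall t, a * W t + b * V t = 0) -> a = 0 /\ b = 0.

Definition realization (L : (R -> R) -> Prop) : Prop :=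
  (forall u, L u -> vector_field u) /\
  (exists W V, independent2 W V /\ forall u, L u <-> span2 W V u) /\
  (forall u v, L u -> L v -> L (bracket u v)) /\
  (exists u v, L u /\ L v /\ exists t, bracket u v t <> 0) /\
  (forall u, L u -> (exists t, u t <> 0) -> classC u).

(* A continuous self-map of R/2piZ is given by a continuous lift f : R -> R.
   The equivalence below says that f descends to the circle (<-) and that the
   induced map is injective (->). *)
Definition circle_bijection (f : R -> R) : Prop :=
  (forall x y, eq_mod_2pi (f x) (f y) <-> eq_mod_2pi x y) /\
  (forall y, exists x, eq_mod_2pi (f x) y).

(* w' is the image of w under f; at the points where f is not C^1 the values
   of w' are determined by continuity. *)
Definition pushes (f w w' : R -> R) : Prop :=
  vector_field w' /\
  forall t, C1_at f t -> w' (f t) = w t * Derive f t.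

Definition equivalence_transformation
    (f : R -> R) (L M : (R -> R) -> Prop) : Prop :=
  circle_bijection f /\
  (forall t, continuous f t) /\
  (exists E : list R, forall t, ~ C1_at f t ->
     exists e, In e E /\ eq_mod_2pi t e) /\
  (forall t, ~ C1_at f t ->
     is_lim (Derive f) t p_infty \/ is_lim (Derive f) t m_infty) /\
  (forall w, L w -> exists w', M w' /\ pushes f w w') /\
  (forall w', M w' -> exists w, L w /\ pushes f w w').

Definition equivalent : relation ((R -> R) -> Prop) :=
  clos_trans _ (fun L M => exists f, equivalence_transformation f L M).

(* The values of s at the division points 2 pi k / n are left unspecified. *)
Definition step_function (n : nat) (c : nat -> R) (s : R -> R) : Prop :=
  periodic_2pi s /\
  forall (k : nat) (t : R), (k < n)%nat ->
    2 * PI * INR k / INR n < t < 2 * PI * INR (k + 1) / INR n -> s t = c k.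

Definition normal_W (n : nat) (sigma : R -> R) : R -> R :=
  fun t => sigma t * (1 - cos (INR n * t)).

Definition normal_V (n : nat) (lambda : R -> R) : R -> R :=
  fun t => / INR n * sin (INR n * t) + lambda t * (1 - cos (INR n * t)).

(* Main.v *)
(** Choose generators with [V,W] = W. On an interval where W has no zero, g = V/W satisfies
    g' = -1/W, which makes |g| tend to infinity at every zero of W; hence V' takes the values
    -1 and 0 in each gap between zeros, and by uniform continuity of V' the circle carries
    finitely many zeros, n >= 1 of them. On each gap g maps the interval monotonically onto
    the line, so that with sigma the sign of W the substitution cot(x/2) = n sigma g, for
    x = n theta, brings the pair to sigma (1 - cos x), sin x / n; in particular lambda = 0
    can always be reached. The derivative of this
    substitution may oscillate at the zeros of W, hence a detour: let Psi be a primitive of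
    a multiple of (1 - cos x)^N commuting with x -> x + 2 pi. If V' <= 2N then V g^(2N) is
    monotone on each gap, which forces the derivative of Psi(x)/n to tend to 0 at the zeros
    of W. The map Psi(x)/n is therefore C1, and the inverse of Psi, whose derivative tends
    to +oo at the multiples of 2 pi, leads from the intermediate pair to the normal form. *)
Require Import Defs.
From Stdlib Require Import Lra Lia ZArith ClassicalEpsilon.

(** The shape of the proof is dictated by the demand that at every point a transformation is C1 or
    has a derivative tending to infinity. The direct substitution theta = x/n has derivative 2 |W| /
    (W^2 + n^2 V^2). Near a zero of W this behaves like 2 |W| / (n^2 V^2), and |W|/|V| -> 0 does not
    decide whether a limit exists. Composing with [Psi] multiplies it by c (1 - cos x)^N, which is
    comparable to (W/V)^(2N). Monotonicity of V g^(2N) yields (W/V)^(2N) <= C |V|, so the product is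
    O(|W/V|) and tends to 0. Hence the choice of the exponent: 2N only has to dominate V' on the
    whole circle. The two maps compose to the direct substitution, which need not be a
    transformation itself; the target is reached because equivalence is a transitive closure. Every
    map used is increasing, the sign of W on a gap being left to sigma. *)

(** * One-variable calculus: mean value arguments, monotonicity, inverse functions *)

Lemma locally_iff (P : R -> Prop) (x : R) :
  locally x P <-> exists d, 0 < d /\ forall y, Rabs (y - x) < d -> P y.
Proof.
  split.
  - intros [d Hd]. exists d. split; [apply cond_pos|]. intros y Hy. apply Hd. exact Hy.
  - intros [d [Hd H]]. exists (mkposreal d Hd). intros y Hy. apply H. exact Hy.
Qed.

Lemma locally_open_interval (P : R -> Prop) (a b x : R) :
  a < x < b -> (forall y, a < y < b -> P y) -> locally x P.
Proof.
  intros Hx H. apply locally_iff. exists (Rmin (x - a) (b - x)). split.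
  - apply Rmin_glb_lt; lra.
  - intros y Hy. apply H.
    pose proof (Rmin_l (x - a) (b - x)). pose proof (Rmin_r (x - a) (b - x)).
    apply Rabs_def2 in Hy. lra.
Qed.

Lemma continuous_eps (f : R -> R) (x : R) :
  continuous f x <-> forall eps, 0 < eps ->
    exists d, 0 < d /\ forall y, Rabs (y - x) < d -> Rabs (f y - f x) < eps.
Proof.
  split.
  - intros H eps He.
    apply (locally_iff (fun y => Rabs (f y - f x) < eps)).
    apply (H (fun z => Rabs (z - f x) < eps)).
    apply locally_iff. exists eps. auto.
  - intros H P [e He].
    destruct (H e (cond_pos e)) as [d [Hd H']].
    apply (proj2 (locally_iff (fun y => P (f y)) x)). exists d. split; auto. intros y Hy. apply He. apply H'. exact Hy.
Qed.

Lemma continuous_continuity_pt (f : R -> R) (x : R) :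
  continuous f x -> continuity_pt f x.
Proof. intros H. apply continuity_pt_filterlim. exact H. Qed.

Lemma is_derive_continuous (f : R -> R) (x l : R) : is_derive f x l -> continuous f x.
Proof. intros H. apply (ex_derive_continuous f). exists l. exact H. Qed.

Lemma MVT_open (f d : R -> R) (a b : R) :
  a < b ->
  (forall t, a <= t <= b -> continuous f t) ->
  (forall t, a < t < b -> is_derive f t (d t)) ->
  exists c, a < c < b /\ f b - f a = d c * (b - a).
Proof.
  intros Hab Hc Hd.
  assert (pr1 : forall c, a < c < b -> derivable_pt f c).
  { intros c Hc'. exists (d c). apply is_derive_Reals, Hd, Hc'. }
  destruct (MVT f id a b pr1 (fun c _ => derivable_pt_id c) Hab) as [c [P H]].
  - intros c Hc'. apply continuous_continuity_pt, Hc, Hc'.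
  - intros c _. apply derivable_continuous_pt, derivable_pt_id.
  - exists c. split; [exact P|].
    rewrite (derive_pt_eq_0 f c (d c) (pr1 c P)) in H by (apply is_derive_Reals, Hd, P).
    rewrite derive_pt_id in H. unfold id in H. lra.
Qed.

(** By the mean value theorem the difference quotient at [x] is a value of [d] at a nearby point.
    This supplies derivatives at division points and at zeros of W, where the formula is first known
    only on both sides. *)
Lemma is_derive_extend (f d : R -> R) (x r : R) :
  0 < r -> continuous f x -> continuous d x ->
  (forall t, Rabs (t - x) < r -> t <> x -> is_derive f t (d t)) ->
  is_derive f x (d x).
Proof.
  intros Hr Hf Hd H.
  apply is_derive_Reals. intros eps He.
  destruct (proj1 (continuous_eps d x) Hd eps He) as [e [He0 He1]].
  assert (Hm : 0 < Rmin e r) by (apply Rmin_glb_lt; lra).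
  exists (mkposreal _ Hm). simpl. intros h Hh0 Hh.
  assert (Hcont : forall t, Rabs (t - x) < r -> continuous f t).
  { intros t Ht. destruct (Req_dec t x) as [->|Hn]; [exact Hf|].
    apply (is_derive_continuous f t (d t)), H; assumption. }
  pose proof (Rmin_l e r). pose proof (Rmin_r e r).
  assert (Hc : exists c, Rabs (c - x) < e /\ (f (x + h) - f x) = d c * h).
  { apply Rabs_def2 in Hh. destruct (Rlt_le_dec 0 h) as [Hp|Hp].
    - destruct (MVT_open f d x (x + h)) as [c [Hc1 Hc2]]; [lra| | |].
      + intros t Ht. apply Hcont, Rabs_def1; lra.
      + intros t Ht. apply H; [apply Rabs_def1; lra | lra].
      + exists c. split; [apply Rabs_def1; lra|]. rewrite Hc2. ring.
    - destruct (MVT_open f d (x + h) x) as [c [Hc1 Hc2]]; [lra| | |].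
      + intros t Ht. apply Hcont, Rabs_def1; lra.
      + intros t Ht. apply H; [apply Rabs_def1; lra | lra].
      + exists c. split; [apply Rabs_def1; lra|]. lra. }
  destruct Hc as [c [Hc1 Hc2]]. rewrite Hc2.
  replace (d c * h / h) with (d c) by (field; exact Hh0).
  apply He1, Hc1.
Qed.

Lemma nonincreasing_of_derive (f d : R -> R) (a b : R) :
  (forall t, a <= t <= b -> is_derive f t (d t)) ->
  (forall t, a <= t <= b -> d t <= 0) ->
  a <= b -> f b <= f a.
Proof.
  intros Hd Hn Hab. destruct (Req_dec a b) as [->|Hne]; [lra|].
  destruct (MVT_open f d a b) as [c [Hc H]]; [lra| | |].
  - intros t Ht. apply (is_derive_continuous f t (d t)), Hd, Ht.
  - intros t Ht. apply Hd. lra.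
  - assert (d c <= 0) by (apply Hn; lra). nra.
Qed.

Lemma constant_of_derive (f : R -> R) (a b : R) :
  (forall t, a < t < b -> is_derive f t 0) ->
  forall x y, a < x < b -> a < y < b -> f x = f y.
Proof.
  intros Hd.
  assert (Hle : forall x y, a < x < b -> a < y < b -> x < y -> f x = f y).
  { intros x y Hx Hy Hxy.
    destruct (MVT_open f (fun _ => 0) x y) as [c [Hc H]]; [lra| | |lra].
    - intros t Ht. apply (is_derive_continuous f t 0), Hd. lra.
    - intros t Ht. apply Hd. lra. }
  intros x y Hx Hy. destruct (Rtotal_order x y) as [H|[->|H]]; auto.
  symmetry. auto.
Qed.

(** Critical points are allowed if they fill no interval: equal values at two points would make [f]
    constant between them, hence [d] zero there. [Psi] and the first transformation both have
    critical points. *)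
Lemma increasing_of_derive (f d : R -> R) :
  (forall t, is_derive f t (d t)) -> (forall t, 0 <= d t) ->
  (forall a b, a < b -> exists t, a < t < b /\ d t <> 0) ->
  forall x y, x < y -> f x < f y.
Proof.
  intros Hd Hp Hn.
  assert (Hle : forall x y, x <= y -> f x <= f y).
  { intros x y Hxy.
    enough (- f y <= - f x) by lra.
    apply (nonincreasing_of_derive (fun t => - f t) (fun t => - d t)); [| |exact Hxy].
    - intros t _. apply (is_derive_opp f t (d t)), Hd.
    - intros t _. specialize (Hp t). lra. }
  intros x y Hxy. destruct (Hle x y) as [H|H]; [lra|exact H|exfalso].
  destruct (Hn x y Hxy) as [t [Ht Hdt]]. apply Hdt.
  rewrite <- (is_derive_unique f t (d t)) by apply Hd.
  apply is_derive_unique, (is_derive_ext_loc (fun _ => f x)).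
  - apply (locally_open_interval _ x y); [exact Ht|].
    intros s Hs. assert (f x <= f s) by (apply Hle; lra).
    assert (f s <= f y) by (apply Hle; lra). lra.
  - apply (is_derive_const (f x) t).
Qed.

Lemma derive_factor (f : R -> R) (x l eps : R) :
  is_derive f x l -> 0 < eps ->
  exists r, 0 < r /\ forall u, Rabs (u - x) < r ->
    Rabs (f u - f x - l * (u - x)) <= eps * Rabs (u - x).
Proof.
  intros H He. apply is_derive_Reals in H. destruct (H eps He) as [d Hd].
  exists d. split; [apply cond_pos|]. intros u Hu.
  destruct (Req_dec u x) as [->|Hne].
  { replace (f x - f x - l * (x - x)) with 0 by ring.
    replace (x - x) with 0 by ring. rewrite Rabs_R0. lra. }
  specialize (Hd (u - x)). replace (x + (u - x)) with u in Hd by ring.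
  replace (f u - f x - l * (u - x)) with (((f u - f x) / (u - x) - l) * (u - x)) by (field; lra).
  rewrite Rabs_mult. apply Rmult_le_compat_r; [apply Rabs_pos|].
  left. apply Hd; [lra|exact Hu].
Qed.

Lemma is_derive_inverse (f g : R -> R) (y l : R) :
  (forall z, f (g z) = z) -> continuous g y -> is_derive f (g y) l -> 0 < l ->
  is_derive g y (/ l).
Proof.
  intros Hfg Hg Hf Hl. apply is_derive_Reals. intros eps He.
  (* The bound l/2 gives |k| <= 2 |h| / l; with it the bound eps l^2 / 4 turns e |k| into at most
     eps l |h| / 2. *)
  set (e := Rmin (l / 2) (eps * l * l / 4)).
  assert (He0 : 0 < e).
  { apply Rmin_glb_lt; [lra|]. assert (0 < eps * l * l) by (repeat apply Rmult_lt_0_compat; lra). lra. }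
  assert (He1 : e <= l / 2) by apply Rmin_l.
  assert (He2 : e <= eps * l * l / 4) by apply Rmin_r.
  destruct (derive_factor f (g y) l e Hf He0) as [r [Hr H]].
  destruct (proj1 (continuous_eps g y) Hg r Hr) as [d [Hd H']].
  exists (mkposreal d Hd). simpl. intros h Hh0 Hh.
  specialize (H (g (y + h))). rewrite !Hfg in H.
  set (k := g (y + h) - g y) in *.
  assert (Hk : Rabs (y + h - y - l * k) <= e * Rabs k).
  { apply H, H'. replace (y + h - y) with h by ring. exact Hh. }
  replace (y + h - y - l * k) with (h - l * k) in Hk by ring.
  assert (Hk1 : l / 2 * Rabs k <= Rabs h).
  { assert (Rabs (l * k) <= Rabs h + Rabs (h - l * k)).
    { pose proof (Rabs_triang h (- (h - l * k))) as Ht.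
      rewrite Rabs_Ropp in Ht. replace (h + - (h - l * k)) with (l * k) in Ht by ring. exact Ht. }
    rewrite Rabs_mult, (Rabs_right l) in H0 by lra.
    pose proof (Rabs_pos k). nra. }
  replace (k / h - / l) with (- ((h - l * k) / (l * h))) by (field; repeat split; lra || assumption).
  assert (Hh' : 0 < Rabs h) by (apply Rabs_pos_lt; exact Hh0).
  rewrite Rabs_Ropp, Rabs_div, Rabs_mult, (Rabs_right l) by (try apply Rmult_integral_contrapositive_currified; lra).
  apply (Rmult_lt_reg_r (l * Rabs h)); [nra|].
  replace (Rabs (h - l * k) / (l * Rabs h) * (l * Rabs h)) with (Rabs (h - l * k)) by (field; lra).
  pose proof (Rabs_pos k).
  assert (e * Rabs k <= eps * l * l / 4 * Rabs k) by nra.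
  assert (eps * l * l / 4 * Rabs k <= eps * l / 2 * Rabs h).
  { replace (eps * l * l / 4 * Rabs k) with (eps * l / 2 * (l / 2 * Rabs k)) by field.
    apply Rmult_le_compat_l; [|lra]. nra. }
  assert (0 < eps * l * Rabs h) by (repeat apply Rmult_lt_0_compat; lra). lra.
Qed.

(** * C1 vector fields on the circle as periodic functions *)

Lemma vector_field_intro (v d : R -> R) :
  periodic_2pi v -> (forall t, is_derive v t (d t)) -> (forall t, continuous d t) ->
  vector_field v.
Proof.
  intros Hp Hd Hc. split; [exact Hp|]. intros t. split.
  - apply filter_forall. intros y. exists (d y). apply Hd.
  - apply (continuous_ext d); [|apply Hc].
    intros s. symmetry. apply is_derive_unique, Hd.
Qed.

Lemma vector_field_derive (v : R -> R) (t : R) :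
  vector_field v -> is_derive v t (Derive v t).
Proof.
  intros [_ H]. apply Derive_correct. apply (locally_singleton t (fun y => ex_derive v y)), H.
Qed.

Lemma vector_field_continuous (v : R -> R) (t : R) : vector_field v -> continuous v t.
Proof. intros H. apply (is_derive_continuous v t (Derive v t)), vector_field_derive, H. Qed.

Lemma vector_field_continuous_derive (v : R -> R) (t : R) :
  vector_field v -> continuous (Derive v) t.
Proof. intros [_ H]. apply H. Qed.

Lemma periodic_shift_Z (v : R -> R) :
  periodic_2pi v -> forall (z : Z) t, v (t + IZR z * (2 * PI)) = v t.
Proof.
  intros Hv.
  assert (Hn : forall (n : nat) t, v (t + INR n * (2 * PI)) = v t).
  { intros n. induction n as [|n IH]; intros t.
    - simpl. f_equal. ring.
    - rewrite S_INR. replace (t + (INR n + 1) * (2 * PI)) with (t + INR n * (2 * PI) + 2 * PI) by ring.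
      rewrite Hv. apply IH. }
  intros z t. destruct (Z_le_gt_dec 0 z) as [Hz|Hz].
  - rewrite <- (Z2Nat.id z Hz), <- INR_IZR_INZ. apply Hn.
  - rewrite <- (Hn (Z.to_nat (- z)) (t + IZR z * (2 * PI))).
    rewrite INR_IZR_INZ, Z2Nat.id by lia. rewrite opp_IZR. f_equal. ring.
Qed.

Lemma Derive_periodic (v : R -> R) : vector_field v -> periodic_2pi (Derive v).
Proof.
  intros Hv t. symmetry. apply is_derive_unique.
  apply (is_derive_ext (fun s => v (s + 2 * PI))).
  - intros s. apply Hv.
  - auto_derive.
    + exists (Derive v (t + 2 * PI)). apply vector_field_derive, Hv.
    + rewrite Rmult_1_l. reflexivity.
Qed.

(** * Generators with [V, W] = W *)

(** Linear independence of the two fields follows from the bracket relation and [classC W], see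
    [affine_pair_nonvanishing]. *)
Definition affine_pair (W V : R -> R) : Prop :=
  vector_field V /\ classC W /\ forall t, bracket V W t = W t.

Lemma is_derive_lin (f g : R -> R) (a b t df dg : R) :
  is_derive f t df -> is_derive g t dg ->
  is_derive (fun s => a * f s + b * g s) t (a * df + b * dg).
Proof.
  intros Hf Hg. apply (is_derive_plus (fun s => a * f s) (fun s => b * g s)).
  - apply (is_derive_scal f). exact Hf.
  - apply (is_derive_scal g). exact Hg.
Qed.

Lemma continuous_lin (f g : R -> R) (a b t : R) :
  continuous f t -> continuous g t -> continuous (fun s => a * f s + b * g s) t.
Proof.
  intros Hf Hg. apply (continuous_plus (fun s => a * f s) (fun s => b * g s)).
  - apply (continuous_scal_r a f). exact Hf.
  - apply (continuous_scal_r b g). exact Hg.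
Qed.

Lemma vector_field_ext (u v : R -> R) :
  (forall t, u t = v t) -> vector_field v -> vector_field u.
Proof.
  intros H Hv. apply (vector_field_intro u (Derive v)).
  - intros t. rewrite !H. apply Hv.
  - intros t. apply (is_derive_ext v); [intros; symmetry; apply H | apply vector_field_derive, Hv].
  - intros t. apply vector_field_continuous_derive, Hv.
Qed.

Lemma vector_field_lin (W V : R -> R) (a b : R) :
  vector_field W -> vector_field V -> vector_field (fun t => a * W t + b * V t).
Proof.
  intros HW HV. apply (vector_field_intro _ (fun t => a * Derive W t + b * Derive V t)).
  - intros t. destruct HW as [HW _], HV as [HV _]. rewrite HW, HV. reflexivity.
  - intros t. apply is_derive_lin; apply vector_field_derive; assumption.
  - intros t. apply continuous_lin; apply vector_field_continuous_derive; assumption.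
Qed.

Lemma Derive_lin (W V : R -> R) (a b t : R) :
  vector_field W -> vector_field V ->
  Derive (fun s => a * W s + b * V s) t = a * Derive W t + b * Derive V t.
Proof.
  intros HW HV. apply is_derive_unique, is_derive_lin; apply vector_field_derive; assumption.
Qed.

(** The bracket is bilinear and alternating, so the determinant of the coordinates comes out. *)
Lemma bracket_lin (W V u v : R -> R) (a b c d : R) :
  vector_field W -> vector_field V ->
  (forall t, u t = a * W t + b * V t) -> (forall t, v t = c * W t + d * V t) ->
  forall t, bracket u v t = (a * d - b * c) * bracket W V t.
Proof.
  intros HW HV Hu Hv t. unfold bracket.
  rewrite (Derive_ext _ _ _ Hu), (Derive_ext _ _ _ Hv), Hu, Hv.
  rewrite !Derive_lin by assumption. ring.
Qed.

Lemma Derive_zero_on (u : R -> R) (p q : R) :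
  (forall t, p < t < q -> u t = 0) -> forall t, p < t < q -> Derive u t = 0.
Proof.
  intros H t Ht. apply is_derive_unique, (is_derive_ext_loc (fun _ => 0)).
  - apply (locally_open_interval _ p q); [exact Ht|]. intros s Hs. symmetry. auto.
  - apply (is_derive_const 0 t).
Qed.

(* If u = aW + bV vanishes on an interval then so do [V,u] = aW and [u,W] = bW. *)
Lemma affine_pair_nonvanishing (W V : R -> R) (a b p q : R) :
  affine_pair W V -> p < q ->
  (forall t, p < t < q -> a * W t + b * V t = 0) -> a = 0 /\ b = 0.
Proof.
  intros [HV [[HW Hne] Hb]] Hpq H.
  assert (HD := Derive_zero_on (fun t => a * W t + b * V t) p q H).
  assert (Hx : exists t, p < t < q /\ W t <> 0).
  { apply NNPP. intros Hno. apply Hne. exists p, q. split; [exact Hpq|].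
    intros t Ht. apply NNPP. intros HWt. apply Hno. exists t. auto. }
  destruct Hx as [t [Ht HWt]].
  specialize (H t Ht). specialize (HD t Ht). specialize (Hb t). unfold bracket in Hb.
  rewrite Derive_lin in HD by assumption.
  split; apply (Rmult_eq_reg_r (W t)); try exact HWt.
  - transitivity (V t * (a * Derive W t + b * Derive V t) - Derive V t * (a * W t + b * V t)).
    + rewrite <- Hb at 1. ring.
    + rewrite H, HD. ring.
  - transitivity ((a * W t + b * V t) * Derive W t - (a * Derive W t + b * Derive V t) * W t).
    + rewrite <- Hb at 1. ring.
    + rewrite H, HD. ring.
Qed.

Lemma realization_affine_pair (W V : R -> R) :
  affine_pair W V -> realization (span2 W V).
Proof.
  intros HP. destruct (HP) as [HV [[HW Hne] Hb]].
  assert (Hvf : forall u, span2 W V u -> vector_field u).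
  { intros u [a [b Hu]]. apply (vector_field_ext _ _ Hu), vector_field_lin; assumption. }
  assert (Hb' : forall t, bracket W V t = - W t).
  { intros t. rewrite <- Hb. unfold bracket. ring. }
  split; [exact Hvf|]. split.
  { exists W, V. split; [|tauto]. intros a b H.
    apply (affine_pair_nonvanishing W V a b 0 1 HP); [lra|auto]. }
  split.
  { intros u v [a [b Hu]] [c [d Hv]]. exists (- (a * d - b * c)), 0. intros t.
    rewrite (bracket_lin W V u v a b c d HW HV Hu Hv), Hb'. ring. }
  split.
  { exists V, W. split; [exists 0, 1; intros; ring|]. split; [exists 1, 0; intros; ring|].
    apply NNPP. intros Hno. apply Hne. exists 0, 1. split; [lra|].
    intros t _. rewrite <- Hb. apply NNPP. intros H. apply Hno. exists t. exact H. }
  intros u Hu [t Ht]. split; [apply Hvf, Hu|].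
  intros [p [q [Hpq H]]]. destruct Hu as [a [b Hu]].
  destruct (affine_pair_nonvanishing W V a b p q HP Hpq) as [-> ->].
  - intros s Hs. rewrite <- Hu. auto.
  - apply Ht. rewrite Hu. ring.
Qed.

(** All brackets are multiples of X = [W0, V0], which is nonzero because some bracket is. So X spans
    the derived algebra and has to be the new W up to a factor. *)
Lemma realization_generators (L : (R -> R) -> Prop) :
  realization L -> exists W V, affine_pair W V /\ forall u, L u <-> span2 W V u.
Proof.
  intros [Hvf [[W0 [V0 [_ HL]]] [Hbr [[u [v [Hu [Hv [t0 Ht0]]]]] HC]]]].
  assert (LW : L W0) by (apply HL; exists 1, 0; intros; ring).
  assert (LV : L V0) by (apply HL; exists 0, 1; intros; ring).
  assert (HW := Hvf _ LW). assert (HV := Hvf _ LV).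
  apply HL in Hu. apply HL in Hv. destruct Hu as [a [b Hu]]. destruct Hv as [c [d Hv]].
  rewrite (bracket_lin W0 V0 u v a b c d HW HV Hu Hv) in Ht0.
  set (X := bracket W0 V0) in *.
  assert (LX : L X) by (apply Hbr; assumption).
  assert (HX0 : X t0 <> 0) by (intros H; apply Ht0; rewrite H; ring).
  destruct (proj1 (HL X) LX) as [al [be HX]].
  assert (Hq : 0 < al * al + be * be).
  { destruct (Req_dec al 0) as [->|]; destruct (Req_dec be 0) as [->|]; try nra.
    exfalso. apply HX0. rewrite HX. ring. }
  set (q := al * al + be * be) in *.
  (* The coordinates (be, -al)/q are (al, be) turned by a right angle and scaled to have determinant
     1 with (al, be), which makes [V, X] = X. *)
  set (V := fun t => be / q * W0 t + - al / q * V0 t).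
  assert (HVv : vector_field V) by (apply vector_field_lin; assumption).
  exists X, V. split.
  - split; [exact HVv|]. split; [apply HC; [exact LX | exists t0; exact HX0]|].
    intros t. rewrite (bracket_lin W0 V0 V X (be / q) (- al / q) al be HW HV (fun _ => eq_refl) HX).
    fold X. replace (be / q * be - - al / q * al) with (q / q) by (unfold q at 1; field; lra).
    field. lra.
  - intros w. rewrite HL. split; intros [x [y Hw]].
    (* These are the coordinates of (x, y) in the orthogonal basis (al, be), (be, -al)/q. *)
    + exists ((x * al + y * be) / q), (x * be - y * al). intros t. rewrite Hw. unfold V. rewrite HX.
      assert (Hqe : q = al * al + be * be) by reflexivity.
      apply (Rmult_eq_reg_r q); [|lra].
      transitivity ((x * al + y * be) * (al * W0 t + be * V0 t) + (x * be - y * al) * (be * W0 t - al * V0 t)).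
      * rewrite Hqe. ring.
      * field. lra.
    + exists (x * al + y * (be / q)), (x * be + y * (- al / q)). intros t. rewrite Hw. unfold V. rewrite HX. ring.
Qed.

(** * The quotient V/W near a zero of W *)

(** The numerator of the quotient rule is minus the bracket, that is -W. *)
Lemma quotient_derive (W V : R -> R) (t : R) :
  affine_pair W V -> W t <> 0 -> is_derive (fun s => V s / W s) t (- / W t).
Proof.
  intros [HV [[HW _] Hb]] H. specialize (Hb t). unfold bracket in Hb.
  replace (- / W t) with ((Derive V t * W t - V t * Derive W t) / (W t) ^ 2).
  - apply (is_derive_div V W); [apply vector_field_derive, HV | apply vector_field_derive, HW | exact H].
  - replace (Derive V t * W t - V t * Derive W t) with (- W t) by (rewrite <- Hb at 1; ring).
    field. exact H.
Qed.

(* Where V does not vanish W solves the linear equation W' = (V' + 1) W / V, hence would vanish to the right of the zero of W. *)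
Lemma zero_W_zero_V (W V : R -> R) (a : R) :
  affine_pair W V -> W a = 0 -> V a = 0.
Proof.
  intros [HV [[HW Hne] Hb]] HWa. apply NNPP. intros HVa. apply Hne.
  set (k := fun t => 2 * (Derive V t + 1) / V t).
  assert (Hk : continuous k a).
  { apply (continuous_mult (fun t => 2 * (Derive V t + 1)) (fun t => / V t)).
    - apply (continuous_scal_r 2 (fun t => Derive V t + 1)).
      apply (continuous_plus (Derive V) (fun _ => 1)); [apply vector_field_continuous_derive, HV | apply continuous_const].
    - apply continuous_Rinv_comp; [apply vector_field_continuous, HV | exact HVa]. }
  destruct (proj1 (continuous_eps k a) Hk 1 Rlt_0_1) as [d1 [Hd1 H1]].
  destruct (proj1 (continuous_eps V a) (vector_field_continuous V a HV) (Rabs (V a))) as [d2 [Hd2 H2]];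
    [apply Rabs_pos_lt, HVa|].
  set (C := k a + 1).
  assert (Hm : 0 < Rmin d1 d2) by (apply Rmin_glb_lt; lra).
  pose proof (Rmin_l d1 d2). pose proof (Rmin_r d1 d2).
  exists a, (a + Rmin d1 d2). split; [lra|]. intros t Ht.
  (* Gronwall's argument: (W^2)' = k W^2 with k < C to the right of [a], so W^2 exp(-C t) does not
     increase from its value 0 at [a]. *)
  enough (Hle : (W t) ^ 2 * exp (- C * t) <= (W a) ^ 2 * exp (- C * a)).
  { rewrite HWa, (pow_i 2), Rmult_0_l in Hle by lia.
    pose proof (exp_pos (- C * t)). pose proof (pow2_ge_0 (W t)).
    apply Rsqr_0_uniq. unfold Rsqr. simpl in *. nra. }
  apply (nonincreasing_of_derive (fun s => (W s) ^ 2 * exp (- C * s))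
     (fun s => (2 * W s * Derive W s - C * (W s) ^ 2) * exp (- C * s))); [| |lra].
  - intros s _. auto_derive.
    + exists (Derive W s). apply vector_field_derive, HW.
    + change (Derive (fun x => W x) s) with (Derive W s). ring.
  - intros s Hs.
    assert (HVs : V s <> 0).
    { intros Hz. assert (Hl : Rabs (V s - V a) < Rabs (V a)) by (apply H2, Rabs_def1; lra).
      rewrite Hz in Hl. replace (0 - V a) with (- V a) in Hl by ring. rewrite Rabs_Ropp in Hl. lra. }
    assert (Hks : k s < C).
    { assert (Hl : Rabs (k s - k a) < 1) by (apply H1, Rabs_def1; lra).
      apply Rabs_def2 in Hl. unfold C. lra. }
    assert (Heq : 2 * W s * Derive W s = k s * (W s) ^ 2).
    { specialize (Hb s). unfold bracket in Hb.
      apply (Rmult_eq_reg_r (V s)); [|exact HVs].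
      replace (2 * W s * Derive W s * V s) with (2 * W s * (V s * Derive W s)) by ring.
      replace (V s * Derive W s) with (W s + Derive V s * W s) by lra.
      unfold k. field. exact HVs. }
    rewrite Heq. pose proof (exp_pos (- C * s)). pose proof (pow2_ge_0 (W s)).
    assert ((k s - C) * (W s)^2 <= 0) by nra. nra.
Qed.

(** Otherwise V/W would be a periodic function with nowhere vanishing derivative, against the mean
    value theorem over one turn. *)
Lemma exists_zero (W V : R -> R) : affine_pair W V -> exists a, W a = 0.
Proof.
  intros HP. destruct (HP) as [HV [[HW _] _]]. apply NNPP. intros Hno.
  assert (Hn : forall t, W t <> 0) by (intros t H; apply Hno; exists t; exact H).
  assert (HPI := PI_RGT_0).
  destruct (MVT_open (fun s => V s / W s) (fun t => - / W t) 0 (0 + 2 * PI)) as [c [_ Hc]].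
  - lra.
  - intros t _. apply (is_derive_continuous _ t (- / W t)), quotient_derive; auto.
  - intros t _. apply quotient_derive; auto.
  - destruct HV as [HV _], HW as [HW _]. rewrite HV, HW in Hc.
    assert (H1 : / W c <> 0) by (apply Rinv_neq_0_compat, Hn). nra.
Qed.

Lemma constant_sign (f : R -> R) (p q : R) :
  (forall t, continuous f t) -> (forall t, p < t < q -> f t <> 0) ->
  exists s, (s = 1 \/ s = -1) /\ forall t, p < t < q -> Rabs (f t) = s * f t.
Proof.
  intros Hc Hn.
  assert (Hxy : forall x y, p < x < q -> p < y < q -> x <= y -> 0 < f x * f y).
  { intros x y Hx Hy Hxy. apply Rnot_le_lt. intros Hle.
    destruct (IVT_cor f x y) as [z [Hz H0]]; [|exact Hxy|exact Hle|].
    - intros t. apply continuous_continuity_pt, Hc.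
    - apply (Hn z); [lra|exact H0]. }
  destruct (Rlt_le_dec p q) as [Hpq|Hpq].
  2:{ exists 1. split; [auto|]. intros t Ht. lra. }
  set (m := (p + q) / 2). assert (Hm : p < m < q) by (unfold m; lra).
  assert (Hmt : forall t, p < t < q -> 0 < f m * f t).
  { intros t Ht. destruct (Rle_dec m t); [apply Hxy; lra | rewrite Rmult_comm; apply Hxy; lra]. }
  destruct (Rlt_le_dec 0 (f m)) as [H|H].
  - exists 1. split; [auto|]. intros t Ht. specialize (Hmt t Ht). rewrite Rabs_right; nra.
  - exists (-1). split; [auto|]. intros t Ht. specialize (Hmt t Ht). rewrite Rabs_left; nra.
Qed.

Lemma Rabs_pm1 (e : R) : e = 1 \/ e = -1 -> Rabs e = 1.
Proof. intros [-> | ->]; unfold Rabs; destruct Rcase_abs; lra. Qed.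

(** In use [s] is the distance to a zero [a] and [e] = 1 or -1 selects the side, so that both sides
    are handled at once; the outer factor [e] cancels the one from the chain rule. *)
Lemma side_quotient_derive (W V : R -> R) (a e s : R) :
  affine_pair W V -> e * e = 1 -> W (a + e * s) <> 0 ->
  is_derive (fun s => e * (V (a + e * s) / W (a + e * s))) s (- / W (a + e * s)).
Proof.
  intros HP He H.
  replace (- / W (a + e * s)) with (e * (e * (- / W (a + e * s)))) by (rewrite <- Rmult_assoc, He; ring).
  apply (is_derive_scal (fun s => V (a + e * s) / W (a + e * s))).
  apply (is_derive_comp (fun t => V t / W t) (fun s => a + e * s) s (- / W (a + e * s)) e).
  - apply (quotient_derive W V); assumption.
  - auto_derive; [exact I|ring].
Qed.

(* With g = V/W one has |g'| = 1/|W| >= 1/(C |t - a|), so |g| grows at least logarithmically at a. *)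
Lemma quotient_blowup (W V : R -> R) (a e s0 : R) :
  affine_pair W V -> W a = 0 -> (e = 1 \/ e = -1) -> 0 < s0 ->
  (forall s, 0 < s < s0 -> W (a + e * s) <> 0) ->
  forall K, exists r, 0 < r <= s0 /\ forall s, 0 < s < r ->
    K * Rabs (W (a + e * s)) < e * V (a + e * s).
Proof.
  intros HP HWa He Hs0 Hn K.
  assert (He1 : e * e = 1) by (destruct He as [-> | ->]; ring).
  destruct (HP) as [HV [[HW _] _]].
  destruct (constant_sign (fun s => W (a + e * s)) 0 s0) as [sg [Hsg Habs]]; [|exact Hn|].
  { intros t. apply (continuous_comp (fun s => a + e * s) W).
    - apply (is_derive_continuous _ t e). auto_derive; [exact I|ring].
    - apply vector_field_continuous, HW. }
  (* W vanishes at [a], so |W| <= C s at small distance s, with C = |W'(a)| + 1. *)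
  destruct (derive_factor W a (Derive W a) 1) as [r [Hr HC]]; [apply vector_field_derive, HW|lra|].
  set (C := Rabs (Derive W a) + 1).
  assert (HC0 : 0 < C) by (unfold C; pose proof (Rabs_pos (Derive W a)); lra).
  assert (HCb : forall s, 0 < s < r -> Rabs (W (a + e * s)) <= C * s).
  { intros s Hs. specialize (HC (a + e * s)). rewrite HWa in HC.
    replace (a + e * s - a) with (e * s) in HC by ring.
    assert (Hes : Rabs (e * s) = s).
    { rewrite Rabs_mult, (Rabs_right s), (Rabs_pm1 e He) by lra. ring. }
    rewrite Hes in HC. specialize (HC (proj2 Hs)).
    pose proof (Rabs_triang (W (a + e * s) - 0 - Derive W a * (e * s)) (Derive W a * (e * s))) as Ht.
    rewrite (Rabs_mult (Derive W a)), Hes in Ht.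
    replace (W (a + e * s) - 0 - Derive W a * (e * s) + Derive W a * (e * s)) with (W (a + e * s)) in Ht by ring.
    unfold C. lra. }
  set (s1 := Rmin r s0 / 2).
  assert (Hs1 : 0 < s1 /\ s1 < r /\ s1 < s0).
  { assert (0 < Rmin r s0) by (apply Rmin_glb_lt; lra).
    pose proof (Rmin_l r s0). pose proof (Rmin_r r s0). unfold s1. lra. }
  set (g := fun s => e * (V (a + e * s) / W (a + e * s))).
  (* The function sg g + (ln s)/C has derivative -1/|W| + 1/(C s) <= 0, so for s < s1 it is at least
     its value [m] at [s1]; [r'] solves m - (ln r')/C = K. *)
  set (m := sg * g s1 + / C * ln s1).
  set (r' := exp (C * (m - K))).
  exists (Rmin s1 r'). pose proof (Rmin_l s1 r'). pose proof (Rmin_r s1 r').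
  assert (0 < Rmin s1 r') by (apply Rmin_glb_lt; [lra|apply exp_pos]).
  split; [lra|]. intros s Hs.
  assert (Hle : m <= sg * g s + / C * ln s).
  { apply (nonincreasing_of_derive (fun s => sg * g s + / C * ln s)
      (fun s => sg * (- / W (a + e * s)) + / C * / s)); [| |lra].
    - intros t Ht. apply (is_derive_lin g ln sg (/ C) t).
      + apply side_quotient_derive; auto. apply Hn. lra.
      + apply is_derive_Reals, derivable_pt_lim_ln. lra.
    - intros t Ht. assert (Ht' : 0 < t < s0) by lra.
      specialize (HCb t). specialize (Habs t Ht'). simpl in Habs. specialize (Hn t Ht').
      assert (Hpos : 0 < Rabs (W (a + e * t))) by (apply Rabs_pos_lt, Hn).
      replace (sg * - / W (a + e * t)) with (- / Rabs (W (a + e * t))).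
      2:{ rewrite Habs. destruct Hsg as [-> | ->]; field; exact Hn. }
      rewrite <- Rinv_mult.
      assert (/ (C * t) <= / Rabs (W (a + e * t))) by (apply Rinv_le_contravar; [exact Hpos|apply HCb; lra]).
      lra. }
  assert (Hln : ln s < C * (m - K)).
  { apply exp_lt_inv. rewrite exp_ln by lra. fold r'. lra. }
  assert (HK : K < sg * g s).
  { assert (/ C * ln s < / C * (C * (m - K))) by (apply Rmult_lt_compat_l; [apply Rinv_0_lt_compat, HC0|exact Hln]).
    replace (/ C * (C * (m - K))) with (m - K) in H2 by (field; lra). lra. }
  assert (Hs' : 0 < s < s0) by lra. specialize (Habs s Hs'). simpl in Habs. specialize (Hn s Hs').
  assert (Hpos : 0 < Rabs (W (a + e * s))) by (apply Rabs_pos_lt, Hn).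
  replace (e * V (a + e * s)) with (sg * g s * Rabs (W (a + e * s))).
  - apply Rmult_lt_compat_r; assumption.
  - rewrite Habs. unfold g. destruct Hsg as [-> | ->]; field; exact Hn.
Qed.

(* V g^(2N) is monotone when V' <= 2N, because V g' = - g. *)
Lemma quotient_power_bound (W V : R -> R) (a e s0 : R) (N : nat) :
  affine_pair W V -> W a = 0 -> (e = 1 \/ e = -1) -> 0 < s0 ->
  (forall s, 0 < s < s0 -> W (a + e * s) <> 0) ->
  (forall t, Derive V t <= INR (2 * N)) ->
  exists c r, 0 < c /\ 0 < r <= s0 /\ forall s, 0 < s < r ->
    c * W (a + e * s) ^ (2 * N) <= Rabs (V (a + e * s)) ^ S (2 * N).
Proof.
  intros HP HWa He Hs0 Hn HN.
  assert (He1 : e * e = 1) by (destruct He as [-> | ->]; ring).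
  destruct (HP) as [HV [[HW _] _]].
  destruct (quotient_blowup W V a e s0 HP HWa He Hs0 Hn 0) as [r [Hr Hb]].
  assert (Hpos : forall s, 0 < s < r -> 0 < e * V (a + e * s)).
  { intros s Hs. specialize (Hb s Hs). lra. }
  set (g := fun s => e * (V (a + e * s) / W (a + e * s))).
  set (Q := fun s => e * V (a + e * s) * g s ^ (2 * N)).
  assert (Heven : forall x, 0 <= x ^ (2 * N)).
  { intros x. rewrite pow_mult. apply pow_le, pow2_ge_0. }
  assert (Hr2 : 0 < r / 2 < r) by lra.
  (* [Q] does not increase with the distance, so its value at r/2 is a positive lower bound nearer
     to [a]; multiplying by W^(2N) gives the claim. *)
  exists (Q (r / 2)), (r / 2).
  assert (HQ : forall s, 0 < s <= r / 2 -> Q (r / 2) <= Q s).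
  { intros s Hs. apply (nonincreasing_of_derive Q
      (fun s => (Derive V (a + e * s) - INR (2 * N)) * g s ^ (2 * N))); [| |lra].
    - intros t Ht. assert (Htn : W (a + e * t) <> 0) by (apply Hn; lra).
      assert (Hg : is_derive g t (- / W (a + e * t))) by (apply side_quotient_derive; assumption).
      assert (HeV : is_derive (fun s => e * V (a + e * s)) t (Derive V (a + e * t))).
      { replace (Derive V (a + e * t)) with (e * (e * Derive V (a + e * t))) by (rewrite <- Rmult_assoc, He1; ring).
        apply (is_derive_scal (fun s => V (a + e * s))).
        apply (is_derive_comp V (fun s => a + e * s) t).
        - apply vector_field_derive, HV.
        - auto_derive; [exact I|ring]. }
      replace ((Derive V (a + e * t) - INR (2 * N)) * g t ^ (2 * N)) with
        (Derive V (a + e * t) * g t ^ (2 * N) + (e * V (a + e * t)) *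
           (INR (2 * N) * (- / W (a + e * t)) * g t ^ pred (2 * N))).
      + apply (is_derive_mult (fun s => e * V (a + e * s)) (fun s => g s ^ (2 * N)) t);
          [exact HeV | apply (is_derive_pow g); exact Hg | exact Rmult_comm].
      (* The split is due to [pred]: for N = 0 the power is constant, otherwise the factor e V/W
         completes the lowered power of [g]. *)
      + destruct N as [|N].
        * simpl. ring.
        * replace (2 * S N)%nat with (S (2 * N + 1)) by lia.
          rewrite Nat.pred_succ, <- tech_pow_Rmult.
          assert (Hgt : e * V (a + e * t) * / W (a + e * t) = g t) by (unfold g, Rdiv; ring).
          transitivity (Derive V (a + e * t) * (g t * g t ^ (2 * N + 1)) - INR (S (2 * N + 1)) *
            (e * V (a + e * t) * / W (a + e * t)) * g t ^ (2 * N + 1)); [ring|].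
          rewrite Hgt. ring.
    - intros t Ht. specialize (HN (a + e * t)). specialize (Heven (g t)). nra. }
  split.
  { unfold Q. apply Rmult_lt_0_compat; [apply Hpos, Hr2|].
    rewrite pow_mult. apply pow_lt. apply pow2_gt_0.
    assert (W (a + e * (r / 2)) <> 0) by (apply Hn; lra).
    specialize (Hpos _ Hr2). unfold g.
    replace (e * (V (a + e * (r / 2)) / W (a + e * (r / 2)))) with
      (e * V (a + e * (r / 2)) * / W (a + e * (r / 2))) by (unfold Rdiv; ring).
    apply Rmult_integral_contrapositive_currified; [lra|apply Rinv_neq_0_compat; assumption]. }
  split; [lra|]. intros s Hs.
  assert (Hsn : W (a + e * s) <> 0) by (apply Hn; lra).
  apply Rle_trans with (Q s * W (a + e * s) ^ (2 * N)).
  { apply Rmult_le_compat_r; [apply Heven|apply HQ; lra]. }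
  right. unfold Q. rewrite Rmult_assoc, <- Rpow_mult_distr.
  replace (g s * W (a + e * s)) with (e * V (a + e * s)) by (unfold g; field; exact Hsn).
  rewrite tech_pow_Rmult. f_equal.
  rewrite <- (Rabs_right (e * V (a + e * s))) by (apply Rle_ge; left; apply Hpos; lra).
  rewrite Rabs_mult, (Rabs_pm1 e He). ring.
Qed.

(** * Periodicity, compactness and the separation of zeros *)

Lemma reduce_mod (c t : R) : exists z : Z, c <= t - IZR z * (2 * PI) < c + 2 * PI.
Proof.
  assert (HPI := PI_RGT_0). exists (Zfloor ((t - c) / (2 * PI))).
  destruct (Zfloor_bound ((t - c) / (2 * PI))) as [H1 H2].
  apply (Rmult_le_compat_r (2 * PI)) in H1; [|lra].
  apply (Rmult_lt_compat_r (2 * PI)) in H2; [|lra].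
  replace ((t - c) / (2 * PI) * (2 * PI)) with (t - c) in * by (field; lra). lra.
Qed.

Lemma periodic_uniformly_continuous (f : R -> R) :
  periodic_2pi f -> (forall t, continuous f t) ->
  forall eps, 0 < eps -> exists d, 0 < d /\ forall x y, Rabs (x - y) < d -> Rabs (f x - f y) < eps.
Proof.
  intros Hp Hc eps He. assert (HPI := PI_RGT_0).
  (* The margin 1 around one period keeps both points inside after a common translation, as they are
     less than 1 apart. *)
  destruct (Heine_cor2 (f := f) (a := -1) (b := 2 * PI + 1)
    (fun x _ => continuous_continuity_pt f x (Hc x)) (mkposreal eps He)) as [d Hd]. simpl in Hd.
  exists (Rmin d 1). split; [apply Rmin_glb_lt; [apply cond_pos|lra]|].
  intros x y Hxy. pose proof (Rmin_l d 1). pose proof (Rmin_r d 1).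
  destruct (reduce_mod 0 x) as [z Hz].
  rewrite <- (periodic_shift_Z f Hp (- z) x), <- (periodic_shift_Z f Hp (- z) y), opp_IZR.
  assert (Hxy' := Rabs_def2 _ _ Hxy).
  apply Hd; try lra.
  replace (x + - IZR z * (2 * PI) - (y + - IZR z * (2 * PI))) with (x - y) by ring. lra.
Qed.

Lemma bounded_of_periodic (f : R -> R) :
  periodic_2pi f -> (forall t, continuous f t) -> exists M, forall t, f t <= M.
Proof.
  intros Hp Hc. assert (HPI := PI_RGT_0).
  destruct (continuity_ab_maj f 0 (2 * PI)) as [m [Hm _]]; [lra| |].
  - intros c _. apply continuous_continuity_pt, Hc.
  - exists (f m). intros t. destruct (reduce_mod 0 t) as [z Hz].
    rewrite <- (periodic_shift_Z f Hp (- z) t), opp_IZR. apply Hm. lra.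
Qed.

(** The supremum of the zeros up to [x] is a zero by continuity. If [x] is itself a zero, then p = x
    and the last clause is empty. *)
Lemma last_zero (f : R -> R) (a x : R) :
  (forall t, continuous f t) -> f a = 0 -> a <= x ->
  exists p, a <= p <= x /\ f p = 0 /\ forall t, p < t <= x -> f t <> 0.
Proof.
  intros Hc Ha Hax.
  destruct (completeness (fun y => y <= x /\ f y = 0)) as [p [Hub Hlub]].
  - exists x. intros y [Hy _]. exact Hy.
  - exists a. auto.
  - assert (Hap : a <= p) by (apply Hub; auto).
    assert (Hpx : p <= x) by (apply Hlub; intros y [Hy _]; exact Hy).
    exists p. split; [auto|]. split.
    + apply NNPP. intros Hp.
      destruct (proj1 (continuous_eps f p) (Hc p) (Rabs (f p))) as [d [Hd H]]; [apply Rabs_pos_lt, Hp|].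
      enough (p <= p - d) by lra. apply Hlub. intros y [Hy Hfy].
      apply Rnot_lt_le. intros Hlt. assert (Hyp : y <= p) by (apply Hub; auto).
      specialize (H y). rewrite Hfy in H. replace (0 - f p) with (- f p) in H by ring.
      rewrite Rabs_Ropp in H. assert (Rabs (f p) < Rabs (f p)); [|lra]. apply H, Rabs_def1; lra.
    + intros t Ht Hft. assert (t <= p) by (apply Hub; split; [lra|exact Hft]). lra.
Qed.

Lemma first_zero (f : R -> R) (b x : R) :
  (forall t, continuous f t) -> f b = 0 -> x <= b ->
  exists q, x <= q <= b /\ f q = 0 /\ forall t, x <= t < q -> f t <> 0.
Proof.
  intros Hc Hb Hxb.
  destruct (last_zero (fun t => f (- t)) (- b) (- x)) as [p [H1 [H2 H3]]].
  - intros t. apply (continuous_comp Ropp f); [|apply Hc].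
    apply (is_derive_continuous Ropp t (-1)). auto_derive; [exact I|ring].
  - rewrite Ropp_involutive. exact Hb.
  - lra.
  - exists (- p). split; [lra|]. split; [exact H2|]. intros t Ht.
    specialize (H3 (- t)). rewrite Ropp_involutive in H3. apply H3. lra.
Qed.

(** V is positive just after [a] and negative just before [b], so it has a zero c between; there the
    bracket relation reads -V'(c) W(c) = W(c). As V also vanishes at [a], Rolle's theorem on (a, c)
    gives the value 0. *)
Lemma gap_derivative_values (W V : R -> R) (a b : R) :
  affine_pair W V -> a < b -> W a = 0 -> W b = 0 -> (forall t, a < t < b -> W t <> 0) ->
  exists c d, a < c < b /\ a < d < b /\ Derive V c = -1 /\ Derive V d = 0.
Proof.
  intros HP Hab Ha Hb Hn. destruct (HP) as [HV [[HW _] Hbr]].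
  destruct (quotient_blowup W V a 1 (b - a) HP Ha (or_introl eq_refl)) with (K := 0) as [r1 [Hr1 H1]];
    [lra|intros s Hs; apply Hn; lra|].
  destruct (quotient_blowup W V b (-1) (b - a) HP Hb (or_intror eq_refl)) with (K := 0) as [r2 [Hr2 H2]];
    [lra|intros s Hs; apply Hn; lra|].
  set (r := Rmin (Rmin r1 r2) (b - a)).
  assert (Hr : 0 < r) by (apply Rmin_glb_lt; [apply Rmin_glb_lt|]; lra).
  assert (r <= b - a) by apply Rmin_r.
  assert (r <= r1 /\ r <= r2).
  { pose proof (Rmin_l (Rmin r1 r2) (b - a)). pose proof (Rmin_l r1 r2). pose proof (Rmin_r r1 r2). unfold r. lra. }
  specialize (H1 (r / 2)). specialize (H2 (r / 2)).
  assert (HV1 : 0 < V (a + 1 * (r / 2))) by lra.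
  assert (HV2 : V (b + -1 * (r / 2)) < 0) by lra.
  destruct (IVT_cor V (a + 1 * (r / 2)) (b + -1 * (r / 2))) as [c [Hc HVc]].
  - intros t. apply continuous_continuity_pt, vector_field_continuous, HV.
  - lra.
  - nra.
  - assert (HVa := zero_W_zero_V W V a HP Ha).
    assert (Hac : a < c < b) by lra.
    destruct (MVT_open V (Derive V) a c) as [d [Hd HVd]].
    + lra.
    + intros t _. apply vector_field_continuous, HV.
    + intros t _. apply vector_field_derive, HV.
    + exists c, d. split; [lra|]. split; [lra|]. split.
      * specialize (Hbr c). unfold bracket in Hbr. rewrite HVc in Hbr.
        apply (Rmult_eq_reg_r (W c)); [lra|apply Hn, Hac].
      * rewrite HVc, HVa in HVd. apply (Rmult_eq_reg_r (c - a)); lra.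
Qed.

(** V' changes by 1 within every gap, so its uniform continuity bounds the length of gaps from
    below. Between two zeros there is a gap, since W does not vanish identically there. *)
Lemma zeros_separated (W V : R -> R) :
  affine_pair W V ->
  exists d, 0 < d /\ forall a b, W a = 0 -> W b = 0 -> a < b -> d <= b - a.
Proof.
  intros HP. destruct (HP) as [HV [[HW Hne] Hbr]].
  destruct (periodic_uniformly_continuous (Derive V)) with (eps := 1) as [d [Hd H]];
    [apply Derive_periodic, HV|intros t; apply vector_field_continuous_derive, HV|lra|].
  exists d. split; [exact Hd|]. intros a b Ha Hb Hab.
  assert (Hx : exists x, a < x < b /\ W x <> 0).
  { apply NNPP. intros Hno. apply Hne. exists a, b. split; [exact Hab|].
    intros t Ht. apply NNPP. intros HWt. apply Hno. exists t. auto. }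
  destruct Hx as [x [Hx HWx]].
  assert (HWc : forall t, continuous W t) by (intros t; apply vector_field_continuous, HW).
  destruct (last_zero W a x HWc Ha) as [p [Hp [HWp Hpn]]]; [lra|].
  destruct (first_zero W b x HWc Hb) as [q [Hq [HWq Hqn]]]; [lra|].
  assert (p <> x) by (intros ->; auto). assert (q <> x) by (intros ->; auto).
  destruct (gap_derivative_values W V p q HP) as [c [e [Hc [He [Hc1 He1]]]]]; auto; try lra.
  { intros t Ht. destruct (Rle_dec t x); [apply Hpn; lra|apply Hqn; lra]. }
  apply Rnot_lt_le. intros Hlt.
  assert (Hl : Rabs (Derive V c - Derive V e) < 1) by (apply H, Rabs_def1; lra).
  rewrite Hc1, He1 in Hl. apply Rabs_def2 in Hl. lra.
Qed.

Lemma next_zero (W V : R -> R) :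
  affine_pair W V ->
  forall x, exists b, x < b /\ W b = 0 /\ forall t, x < t < b -> W t <> 0.
Proof.
  intros HP x. destruct (zeros_separated W V HP) as [d [Hd Hsep]].
  destruct (HP) as [HV [[HW Hne] Hbr]].
  assert (HWc : forall t, continuous W t) by (intros t; apply vector_field_continuous, HW).
  destruct (classic (exists z, x < z < x + d /\ W z = 0)) as [[z [Hz HWz]]|Hno].
  - exists z. split; [lra|]. split; [exact HWz|]. intros t Ht HWt.
    specialize (Hsep t z HWt HWz). lra.
  - destruct (exists_zero W V HP) as [a Ha].
    destruct (reduce_mod (x + d) a) as [k Hk].
    (* The search starts at x + d/2 because [x] itself may be a zero, while in this case (x, x + d)
       contains none. *)
    destruct (first_zero W (a - IZR k * (2 * PI)) (x + d / 2) HWc) as [q [Hq [HWq Hqn]]].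
    + rewrite <- Ha, <- (periodic_shift_Z W (proj1 HW) (- k) a), opp_IZR. f_equal. ring.
    + lra.
    + exists q. split; [lra|]. split; [exact HWq|]. intros t Ht.
      destruct (Rlt_le_dec t (x + d / 2)); [|apply Hqn; lra].
      intros HWt. apply Hno. exists t. split; [lra|exact HWt].
Qed.

(** * Enumeration of the zeros of W *)

(** The zeros are listed along the universal cover, so that gaps have integer indices and [n], the
    number of zeros on the circle, is the period of the index. *)
Definition zero_enumeration (W : R -> R) (n : nat) (a : Z -> R) : Prop :=
  (forall z, W (a z) = 0) /\
  (forall z, a z < a (z + 1)%Z) /\
  (forall z t, a z < t < a (z + 1)%Z -> W t <> 0) /\
  (forall z, a (z + Z.of_nat n)%Z = a z + 2 * PI) /\
  (forall t, exists z, a z <= t < a (z + 1)%Z).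

Lemma exists_zero_enumeration (W V : R -> R) :
  affine_pair W V -> exists n a, (1 <= n)%nat /\ zero_enumeration W n a.
Proof.
  intros HP. assert (HPI := PI_RGT_0).
  destruct (zeros_separated W V HP) as [d [Hd Hsep]].
  destruct (exists_zero W V HP) as [a0 Ha0].
  assert (Hper : periodic_2pi W) by apply HP.
  destruct (constructive_indefinite_description
    (fun nx : R -> R => forall x, x < nx x /\ W (nx x) = 0 /\ forall t, x < t < nx x -> W t <> 0)) as [nx Hnx].
  { exists (fun x => proj1_sig (constructive_indefinite_description _ (next_zero W V HP x))).
    intros x. exact (proj2_sig (constructive_indefinite_description _ (next_zero W V HP x))). }
  set (A := fun k => Nat.iter k nx a0).
  assert (HA0 : A 0%nat = a0) by reflexivity.
  assert (HAS : forall k, A (S k) = nx (A k)) by reflexivity.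
  assert (HWA : forall k, W (A k) = 0) by (intros [|k]; [exact Ha0|rewrite HAS; apply Hnx]).
  assert (HAd : forall k, A k + d <= A (S k)).
  { intros k. specialize (Hsep (A k) (A (S k)) (HWA k) (HWA (S k))).
    rewrite HAS in *. specialize (proj1 (Hnx (A k))). lra. }
  assert (HAk : forall k, a0 + INR k * d <= A k).
  { intros k. induction k as [|k IH]; [rewrite Rmult_0_l, HA0; lra|].
    rewrite S_INR. specialize (HAd k). lra. }
  assert (Hex : exists k, a0 + 2 * PI <= A k).
  { destruct (INR_unbounded (2 * PI / d)) as [k Hk]. exists k.
    apply Rle_trans with (2 := HAk k).
    apply (Rmult_gt_compat_r d) in Hk; [|exact Hd].
    replace (2 * PI / d * d) with (2 * PI) in Hk by (field; lra). lra. }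
  assert (Hleast : exists n, a0 + 2 * PI <= A n /\ forall k, (k < n)%nat -> A k < a0 + 2 * PI).
  { destruct Hex as [k Hk]. revert Hk. induction k as [k IH] using lt_wf_ind. intros Hk.
    destruct (classic (exists j, (j < k)%nat /\ a0 + 2 * PI <= A j)) as [[j [Hj Hj']]|Hno].
    - apply (IH j Hj Hj').
    - exists k. split; [exact Hk|]. intros j Hj. apply Rnot_le_lt. intros Hle. apply Hno. exists j. auto. }
  destruct Hleast as [n [Hn1 Hn2]].
  assert (Hn0 : (1 <= n)%nat).
  { destruct n as [|n]; [|lia]. rewrite HA0 in Hn1. lra. }
  (* The point a0 + 2 pi is a zero, so the step that first reaches it cannot jump over it. *)
  assert (HAn : A n = a0 + 2 * PI).
  { destruct n as [|n]; [lia|]. apply Rle_antisym; [|exact Hn1]. apply Rnot_lt_le. intros Hlt.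
    specialize (Hn2 n (Nat.lt_succ_diag_r n)). rewrite HAS in Hlt.
    apply (proj2 (proj2 (Hnx (A n))) (a0 + 2 * PI)); [lra|]. rewrite Hper. exact Ha0. }
  set (a := fun z => A (Z.to_nat (z mod Z.of_nat n)) + IZR (z / Z.of_nat n) * (2 * PI)).
  assert (Hrep : forall (k : nat) q, (k < n)%nat ->
     a (q * Z.of_nat n + Z.of_nat k)%Z = A k + IZR q * (2 * PI)).
  { intros k q Hk. unfold a.
    rewrite (Z.add_comm (q * Z.of_nat n)), Z_mod_plus_full, Z_div_plus_full by lia.
    rewrite Z.mod_small, Z.div_small by lia. rewrite Nat2Z.id. reflexivity. }
  (* Allowing k = n covers the carry into the next turn, so that successors of indices need no case
     distinction. *)
  assert (Hrep' : forall (k : nat) q, (k <= n)%nat ->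
     a (q * Z.of_nat n + Z.of_nat k)%Z = A k + IZR q * (2 * PI)).
  { intros k q Hk. destruct (Nat.eq_dec k n) as [->|Hne]; [|apply Hrep; lia].
    replace (q * Z.of_nat n + Z.of_nat n)%Z with ((q + 1) * Z.of_nat n + Z.of_nat 0)%Z by lia.
    rewrite Hrep by lia. rewrite HA0, HAn, plus_IZR. ring. }
  assert (Hz : forall z, exists k q, (k < n)%nat /\ z = (q * Z.of_nat n + Z.of_nat k)%Z).
  { intros z. exists (Z.to_nat (z mod Z.of_nat n)), (z / Z.of_nat n)%Z.
    pose proof (Z.mod_pos_bound z (Z.of_nat n)). split; [lia|].
    rewrite Z2Nat.id by lia. rewrite (Z.mul_comm (z / _)). apply Z.div_mod. lia. }
  assert (Hgap : forall z, exists k q, (k < n)%nat /\ z = (q * Z.of_nat n + Z.of_nat k)%Z /\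
    a z = A k + IZR q * (2 * PI) /\ a (z + 1)%Z = A (S k) + IZR q * (2 * PI)).
  { intros z. destruct (Hz z) as [k [q [Hk ->]]]. exists k, q. split; [exact Hk|]. split; [reflexivity|].
    split; [apply Hrep, Hk|]. rewrite <- Hrep' by lia. f_equal. lia. }
  exists n, a. split; [exact Hn0|]. repeat split.
  - intros z. destruct (Hgap z) as [k [q [_ [_ [-> _]]]]]. rewrite periodic_shift_Z by exact Hper. apply HWA.
  - intros z. destruct (Hgap z) as [k [q [_ [_ [-> ->]]]]]. specialize (HAd k). lra.
  - intros z t Ht. destruct (Hgap z) as [k [q [_ [_ [H1 H2]]]]]. rewrite H1, H2 in Ht.
    rewrite <- (periodic_shift_Z W Hper (- q) t). rewrite HAS in Ht.
    apply (Hnx (A k)). rewrite opp_IZR. lra.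
  - intros z. destruct (Hgap z) as [k [q [Hk [Hzq [H1 _]]]]]. rewrite H1.
    replace (z + Z.of_nat n)%Z with ((q + 1) * Z.of_nat n + Z.of_nat k)%Z by lia.
    rewrite Hrep by exact Hk. rewrite plus_IZR. ring.
  - intros t. destruct (reduce_mod a0 t) as [q Hq].
    assert (Hk : forall m, (m <= n)%nat -> t - IZR q * (2 * PI) < A m ->
       exists k, (k < m)%nat /\ A k <= t - IZR q * (2 * PI) < A (S k)).
    { intros m. induction m as [|m IH]; intros Hm Hlt; [rewrite HA0 in Hlt; lra|].
      destruct (Rlt_le_dec (t - IZR q * (2 * PI)) (A m)) as [H|H].
      - destruct IH as [k [Hk1 Hk2]]; [lia|exact H|]. exists k. split; [lia|exact Hk2].
      - exists m. split; [lia|]. split; assumption. }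
    destruct (Hk n) as [k [Hkn Hk']]; [lia|lra|].
    exists (q * Z.of_nat n + Z.of_nat k)%Z.
    replace (q * Z.of_nat n + Z.of_nat k + 1)%Z with (q * Z.of_nat n + Z.of_nat (S k))%Z by lia.
    rewrite !Hrep' by lia. lra.
Qed.

(** * Lifts of orientation-preserving homeomorphisms of the circle *)

Definition lift (f : R -> R) : Prop :=
  (forall x y, x < y -> f x < f y) /\ (forall t, continuous f t) /\
  (forall t, f (t + 2 * PI) = f t + 2 * PI).

Lemma lift_shift_Z (f : R -> R) :
  (forall t, f (t + 2 * PI) = f t + 2 * PI) ->
  forall (z : Z) t, f (t + IZR z * (2 * PI)) = f t + IZR z * (2 * PI).
Proof.
  intros Hf z t.
  assert (Hp : periodic_2pi (fun x => f x - x)) by (intros x; rewrite Hf; ring).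
  generalize (periodic_shift_Z _ Hp z t). simpl. lra.
Qed.

Lemma lift_injective (f : R -> R) (x y : R) : lift f -> f x = f y -> x = y.
Proof.
  intros [Hinc _] H. destruct (Rtotal_order x y) as [Hl|[He|Hl]]; [|exact He|];
    apply Hinc in Hl; lra.
Qed.

Lemma lift_surjective (f : R -> R) : lift f -> forall y, exists x, f x = y.
Proof.
  intros [_ [Hc Hp]] y. assert (HPI := PI_RGT_0).
  destruct (reduce_mod (f 0) y) as [z Hz].
  destruct (IVT_gen f (IZR z * (2 * PI)) (IZR (z + 1) * (2 * PI)) y) as [x [_ Hx]].
  - intros t. apply continuous_continuity_pt, Hc.
  - rewrite <- (Rplus_0_l (IZR z * _)), <- (Rplus_0_l (IZR (z + 1) * _)), !lift_shift_Z by exact Hp.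
    rewrite plus_IZR. rewrite Rmin_left, Rmax_right by lra. lra.
  - exists x. exact Hx.
Qed.

Lemma lift_circle_bijection (f : R -> R) : lift f -> circle_bijection f.
Proof.
  intros Hf. split.
  - intros x y. destruct (Hf) as [_ [_ Hp]]. split; intros [z Hz]; exists z.
    + apply (lift_injective f _ _ Hf). rewrite lift_shift_Z by exact Hp. exact Hz.
    + rewrite Hz. apply lift_shift_Z, Hp.
  - intros y. destruct (lift_surjective f Hf y) as [x Hx]. exists x, 0%Z. rewrite Hx. ring.
Qed.

(** Choice picks the preimages. Continuity of the inverse needs only monotonicity: the images of g y
    - eps and g y + eps enclose a neighbourhood of [y]. *)
Lemma lift_inverse (f : R -> R) :
  lift f -> exists g, lift g /\ (forall x, g (f x) = x) /\ (forall y, f (g y) = y).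
Proof.
  intros Hf. destruct (Hf) as [Hinc [Hc Hp]].
  set (g := fun y => proj1_sig (constructive_indefinite_description _ (lift_surjective f Hf y))).
  assert (Hfg : forall y, f (g y) = y).
  { intros y. exact (proj2_sig (constructive_indefinite_description _ (lift_surjective f Hf y))). }
  assert (Hgf : forall x, g (f x) = x) by (intros x; apply (lift_injective f _ _ Hf), Hfg).
  assert (Hginc : forall x y, x < y -> g x < g y).
  { intros x y Hxy. apply Rnot_le_lt. intros [Hle|Heq].
    - apply Hinc in Hle. rewrite !Hfg in Hle. lra.
    - rewrite <- (Hfg x), <- (Hfg y), Heq in Hxy. lra. }
  exists g. split; [|split; assumption]. split; [exact Hginc|]. split.
  - intros y. apply continuous_eps. intros eps He.
    assert (H1 : f (g y - eps) < y) by (rewrite <- (Hfg y) at 2; apply Hinc; lra).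
    assert (H2 : y < f (g y + eps)) by (rewrite <- (Hfg y) at 1; apply Hinc; lra).
    exists (Rmin (y - f (g y - eps)) (f (g y + eps) - y)). split; [apply Rmin_glb_lt; lra|].
    intros u Hu. apply Rabs_def2 in Hu.
    pose proof (Rmin_l (y - f (g y - eps)) (f (g y + eps) - y)).
    pose proof (Rmin_r (y - f (g y - eps)) (f (g y + eps) - y)).
    assert (g (f (g y - eps)) < g u) by (apply Hginc; lra).
    assert (g u < g (f (g y + eps))) by (apply Hginc; lra).
    rewrite Hgf in *. apply Rabs_def1; lra.
  - intros t. apply (lift_injective f _ _ Hf). rewrite Hp, !Hfg. reflexivity.
Qed.

(** * Trigonometric facts and the flattening map *)

Lemma cos_periodic : periodic_2pi cos.
Proof. intros t. replace (t + 2 * PI) with (t + 2 * INR 1 * PI) by (simpl; ring). apply cos_period. Qed.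

Lemma sin_periodic : periodic_2pi sin.
Proof. intros t. replace (t + 2 * PI) with (t + 2 * INR 1 * PI) by (simpl; ring). apply sin_period. Qed.

Lemma cos_2piZ (z : Z) : cos (IZR z * (2 * PI)) = 1.
Proof. rewrite <- (Rplus_0_l (IZR z * _)), (periodic_shift_Z cos cos_periodic). apply cos_0. Qed.

Lemma sin_2piZ (z : Z) : sin (IZR z * (2 * PI)) = 0.
Proof. rewrite <- (Rplus_0_l (IZR z * _)), (periodic_shift_Z sin sin_periodic). apply sin_0. Qed.

Lemma one_minus_cos_pos (z : Z) (x : R) :
  IZR z * (2 * PI) < x < IZR (z + 1) * (2 * PI) -> 0 < 1 - cos x.
Proof.
  intros Hx. rewrite plus_IZR in Hx.
  rewrite <- (periodic_shift_Z cos cos_periodic (- z) x), opp_IZR.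
  set (y := x + - IZR z * (2 * PI)).
  assert (0 < sin (y / 2)) by (apply sin_gt_0; unfold y; lra).
  replace y with (2 * (y / 2)) by field. rewrite cos_2a_sin. nra.
Qed.

Lemma cos_not_1_on_interval (p q : R) : p < q -> exists t, p < t < q /\ 0 < 1 - cos t.
Proof.
  intros Hpq. assert (HPI := PI_RGT_0).
  set (z := Zfloor (p / (2 * PI))).
  destruct (Zfloor_bound (p / (2 * PI))) as [H1 H2]. fold z in H1, H2.
  apply (Rmult_le_compat_r (2 * PI)) in H1; [|lra].
  apply (Rmult_lt_compat_r (2 * PI)) in H2; [|lra].
  replace (p / (2 * PI) * (2 * PI)) with p in * by (field; lra).
  set (b := Rmin q (IZR (z + 1) * (2 * PI))).
  assert (p < b) by (apply Rmin_glb_lt; [exact Hpq|rewrite plus_IZR; lra]).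
  assert (b <= q) by apply Rmin_l.
  assert (b <= IZR (z + 1) * (2 * PI)) by apply Rmin_r.
  exists ((p + b) / 2). split; [lra|]. apply (one_minus_cos_pos z). lra.
Qed.

Lemma division_cases (Y : R) :
  exists z, Y = IZR z * (2 * PI) \/ IZR z * (2 * PI) < Y < IZR (z + 1) * (2 * PI).
Proof.
  destruct (reduce_mod 0 Y) as [z Hz]. exists z. rewrite plus_IZR.
  destruct (Req_dec Y (IZR z * (2 * PI))); [left; assumption|right; lra].
Qed.

Lemma continuous_one_minus_cos_pow (N : nat) (x : R) : continuous (fun x => (1 - cos x) ^ N) x.
Proof.
  apply (ex_derive_continuous (fun x => (1 - cos x) ^ N)). auto_derive. exact I.
Qed.

(* At x = 2 pi z the function Psi(x) - 2 pi z vanishes to order 2N + 1. *)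
Definition flattening (N : nat) (c : R) (Psi Theta : R -> R) : Prop :=
  0 < c /\ (forall x, is_derive Psi x (c * (1 - cos x) ^ N)) /\ lift Psi /\ lift Theta /\
  (forall x, Theta (Psi x) = x) /\ (forall y, Psi (Theta y) = y) /\ Psi 0 = 0.

(** The trivial case N = 0 makes the normal form an instance of the intermediate fields. *)
Lemma flattening_id : flattening 0 1 (fun x => x) (fun x => x).
Proof.
  assert (lift (fun x => x)).
  { split; [auto|]. split; [intros t; apply continuous_id|reflexivity]. }
  split; [lra|]. split; [|tauto]. intros x. simpl. rewrite Rmult_1_r. apply (is_derive_id x).
Qed.

Lemma exists_flattening (N : nat) : exists c Psi Theta, flattening N c Psi Theta.
Proof.
  assert (HPI := PI_RGT_0).
  set (f := fun x => (1 - cos x) ^ N).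
  assert (Hfc : forall x, continuous f x) by apply continuous_one_minus_cos_pow.
  assert (Hf0 : forall x, 0 <= f x) by (intros x; apply pow_le; pose proof (COS_bound x); lra).
  set (P := fun x => RInt f 0 x).
  assert (HP : forall x, is_derive P x (f x)).
  { intros x. apply (is_derive_RInt f P 0 x); [|apply Hfc].
    apply filter_forall. intros y. apply (RInt_correct f), ex_RInt_continuous. intros; apply Hfc. }
  assert (HP0 : P 0 = 0) by apply (RInt_point 0 f).
  assert (HPi : forall x y, x < y -> P x < P y).
  { apply (increasing_of_derive P f); [exact HP|exact Hf0|].
    intros a b Hab. destruct (cos_not_1_on_interval a b Hab) as [t [Ht Hc]].
    exists t. split; [exact Ht|]. apply Rgt_not_eq, pow_lt, Hc. }
  assert (HI : 0 < P (2 * PI)) by (rewrite <- HP0; apply HPi; lra).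
  (* This normalises the integral of the derivative of [Psi] over one turn to 2 pi. *)
  set (c := 2 * PI / P (2 * PI)).
  assert (Hc : 0 < c) by (apply Rdiv_lt_0_compat; lra).
  set (Psi := fun x => c * P x).
  assert (HPsi : forall x, is_derive Psi x (c * f x)).
  { intros x. apply (is_derive_scal P). apply HP. }
  assert (Hper : forall t, Psi (t + 2 * PI) = Psi t + 2 * PI).
  { intros t.
    assert (H : Psi (t + 2 * PI) - Psi t = Psi (0 + 2 * PI) - Psi 0).
    (* The interval is chosen to contain both [t] and 0. *)
    { apply (constant_of_derive (fun t => Psi (t + 2 * PI) - Psi t) (- Rabs t - 1) (Rabs t + 1));
        [| pose proof (Rabs_pos t); unfold Rabs in *; destruct Rcase_abs; lra
         | pose proof (Rabs_pos t); lra].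
      intros s _. replace 0 with (1 * (c * f (s + 2 * PI)) - c * f s).
      - apply (is_derive_minus (fun s => Psi (s + 2 * PI)) Psi); [|apply HPsi].
        apply (is_derive_comp Psi (fun s => s + 2 * PI)); [apply HPsi|]. auto_derive; [exact I|ring].
      - unfold f. rewrite cos_periodic. ring. }
    rewrite Rplus_0_l in H. unfold Psi in H at 3 4. rewrite HP0 in H. unfold c in H.
    replace (2 * PI / P (2 * PI) * P (2 * PI)) with (2 * PI) in H by (field; lra). lra. }
  assert (HL : lift Psi).
  { split; [|split; [|exact Hper]].
    - intros x y Hxy. apply Rmult_lt_compat_l; [exact Hc|apply HPi, Hxy].
    - intros t. apply (is_derive_continuous Psi t (c * f t)), HPsi. }
  destruct (lift_inverse Psi HL) as [Theta [HT [H1 H2]]].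
  exists c, Psi, Theta. repeat (split; [assumption|]). unfold Psi. rewrite HP0. ring.
Qed.

Lemma lift_fixes_2piZ (f : R -> R) (z : Z) :
  lift f -> f 0 = 0 -> f (IZR z * (2 * PI)) = IZR z * (2 * PI).
Proof.
  intros [_ [_ Hp]] H0. rewrite <- (Rplus_0_l (IZR z * _)), lift_shift_Z, H0 by exact Hp. ring.
Qed.

Lemma lift_preserves_gap (f : R -> R) (z : Z) (x : R) :
  lift f -> f 0 = 0 -> IZR z * (2 * PI) < x < IZR (z + 1) * (2 * PI) ->
  IZR z * (2 * PI) < f x < IZR (z + 1) * (2 * PI).
Proof.
  intros Hf H0 Hx. rewrite <- (lift_fixes_2piZ f z Hf H0) at 1. rewrite <- (lift_fixes_2piZ f (z + 1) Hf H0).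
  split; apply Hf; lra.
Qed.

Lemma flattening_Theta_0 (N : nat) (c : R) (Psi Theta : R -> R) :
  flattening N c Psi Theta -> Theta 0 = 0.
Proof. intros [_ [_ [_ [_ [H [_ H0]]]]]]. rewrite <- H0 at 1. apply H. Qed.

Lemma flattening_inverse_derive (N : nat) (c : R) (Psi Theta : R -> R) (Y : R) :
  flattening N c Psi Theta -> 0 < 1 - cos (Theta Y) ->
  is_derive Theta Y (/ (c * (1 - cos (Theta Y)) ^ N)).
Proof.
  intros [Hc [HPsi [_ [[_ [HT _]] [_ [H _]]]]]] Hpos. apply (is_derive_inverse Psi); auto.
  apply Rmult_lt_0_compat; [exact Hc|apply pow_lt, Hpos].
Qed.

(** * Step functions and the intermediate pair *)

(** At a division point the value is that of the interval to the right. The choice is harmless: what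
    a nonconstant step multiplies below vanishes there. *)
Definition step (n : nat) (s : Z -> R) (y : R) : R := s (Zfloor (INR n * y / (2 * PI))).

Lemma step_on_gap (n : nat) (s : Z -> R) (z : Z) (y : R) :
  IZR z * (2 * PI) <= INR n * y < IZR (z + 1) * (2 * PI) -> step n s y = s z.
Proof.
  intros Hy. assert (HPI := PI_RGT_0). unfold step. f_equal. apply Zfloor_eq.
  rewrite plus_IZR in Hy.
  assert (E : INR n * y / (2 * PI) * (2 * PI) = INR n * y) by (field; lra).
  split.
  - apply (Rmult_le_reg_r (2 * PI)); lra.
  - apply (Rmult_lt_reg_r (2 * PI)); lra.
Qed.

Lemma step_periodic (n : nat) (s : Z -> R) :
  (forall z, s (z + Z.of_nat n)%Z = s z) -> periodic_2pi (step n s).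
Proof.
  intros Hs t. assert (HPI := PI_RGT_0). unfold step.
  replace (INR n * (t + 2 * PI) / (2 * PI)) with (INR n * t / (2 * PI) + IZR (Z.of_nat n))
    by (rewrite <- INR_IZR_INZ; field; lra).
  rewrite Zfloor_addz. apply Hs.
Qed.

Lemma scaled_interval (n p q y : R) : 0 < n -> (p < n * y < q <-> p / n < y < q / n).
Proof.
  intros Hn. rewrite (Rlt_div_l p y n Hn), <- (Rlt_div_r y q n Hn), (Rmult_comm y). tauto.
Qed.

(** The factor [s] may jump, since a factor of absolute value 1 preserves the limit 0. *)
Lemma continuous_mult_vanishing (s h : R -> R) (x : R) :
  (forall t, Rabs (s t) = 1) -> continuous h x -> h x = 0 -> continuous (fun t => s t * h t) x.
Proof.
  intros Hs Hh H0. apply continuous_eps. intros eps He.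
  destruct (proj1 (continuous_eps h x) Hh eps He) as [d [Hd H]].
  exists d. split; [exact Hd|]. intros y Hy. specialize (H y Hy).
  rewrite H0, Rmult_0_r, Rminus_0_r in *. rewrite Rabs_mult, Hs. lra.
Qed.

(* H' is divisible by Psi', which cancels the infinite derivative of Theta at the multiples of 2 pi. *)
Lemma step_field_derive (n N : nat) (c : R) (Psi Theta H h : R -> R) (s : Z -> R) :
  (1 <= n)%nat -> flattening N c Psi Theta ->
  (forall x, is_derive H x (c * (1 - cos x) ^ N * (h x / INR n))) ->
  (forall x, continuous h x) ->
  (forall z, s z = 1 \/ s z = -1) ->
  (forall z, s z = s 0%Z) \/ (forall z, H (IZR z * (2 * PI)) = 0 /\ h (IZR z * (2 * PI)) = 0) ->
  forall y,
    is_derive (fun y => step n s y * H (Theta (INR n * y))) y (step n s y * h (Theta (INR n * y))) /\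
    continuous (fun y => step n s y * h (Theta (INR n * y))) y.
Proof.
  intros Hn HF HH Hh Hs Hdiv.
  assert (HPI := PI_RGT_0).
  assert (Hn0 : 0 < INR n) by (apply lt_0_INR; lia).
  destruct (HF) as [Hc [HPsi [HPl [HTl [HTP [HPT HP0]]]]]].
  assert (HT0 := flattening_Theta_0 N c Psi Theta HF).
  assert (HTc : forall y, continuous (fun y => Theta (INR n * y)) y).
  { intros y. apply (continuous_comp (fun y => INR n * y) Theta); [|apply HTl].
    apply (is_derive_continuous _ y (INR n)). auto_derive; [exact I|ring]. }
  (* There are two ways to survive the jumps of the step: a constant sign, used for V, whose
     derivative is not 0 at division points, or a factor vanishing there, used for W. *)
  assert (Hcomp : forall k y, (forall x, continuous k x) ->
    (forall z, s z = s 0%Z) \/ (forall z, k (IZR z * (2 * PI)) = 0) ->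
    continuous (fun y => step n s y * k (Theta (INR n * y))) y).
  { intros k y Hk Hor.
    assert (Hk' : forall y, continuous (fun y => k (Theta (INR n * y))) y).
    { intros u. apply (continuous_comp (fun y => Theta (INR n * y)) k); [apply HTc|apply Hk]. }
    destruct Hor as [Hs0|Hk0].
    { apply (continuous_ext (fun y => s 0%Z * k (Theta (INR n * y)))).
      - intros t. unfold step. rewrite (Hs0 (Zfloor _)). reflexivity.
      - apply (continuous_scal_r (s 0%Z) (fun y => k (Theta (INR n * y)))), Hk'. }
    destruct (division_cases (INR n * y)) as [z [Hz|Hz]].
    - apply continuous_mult_vanishing; [|apply Hk'|].
      + intros t. apply Rabs_pm1, Hs.
      + rewrite Hz, (lift_fixes_2piZ Theta z HTl HT0). apply Hk0.
    - apply (continuous_ext_loc _ (fun y => s z * k (Theta (INR n * y)))).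
      + apply (locally_open_interval _ (IZR z * (2 * PI) / INR n) (IZR (z + 1) * (2 * PI) / INR n)).
        * apply scaled_interval; assumption.
        * intros t Ht. apply scaled_interval in Ht; [|exact Hn0].
          rewrite (step_on_gap n s z t) by lra. reflexivity.
      + apply (continuous_scal_r (s z) (fun y => k (Theta (INR n * y)))), Hk'. }
  assert (HHc : forall x, continuous H x) by (intros x; apply (is_derive_continuous H x _ (HH x))).
  assert (Hcd : forall y, continuous (fun y => step n s y * h (Theta (INR n * y))) y).
  { intros y. apply Hcomp; [exact Hh|]. destruct Hdiv; [left|right; intros; apply H0]; assumption. }
  assert (Hgap : forall y z, IZR z * (2 * PI) < INR n * y < IZR (z + 1) * (2 * PI) ->
    is_derive (fun y => step n s y * H (Theta (INR n * y))) y (step n s y * h (Theta (INR n * y)))).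
  { intros y z Hz.
    apply (is_derive_ext_loc (fun y => s z * H (Theta (INR n * y)))).
    - apply (locally_open_interval _ (IZR z * (2 * PI) / INR n) (IZR (z + 1) * (2 * PI) / INR n)).
      + apply scaled_interval; assumption.
      + intros t Ht. apply scaled_interval in Ht; [|exact Hn0].
        rewrite (step_on_gap n s z t) by lra. reflexivity.
    - rewrite (step_on_gap n s z y) by lra.
      apply (is_derive_scal (fun y => H (Theta (INR n * y)))).
      assert (Hpos : 0 < 1 - cos (Theta (INR n * y))).
      { apply (one_minus_cos_pos z), lift_preserves_gap; assumption. }
      assert (Hpow : (1 - cos (Theta (INR n * y))) ^ N <> 0) by (apply Rgt_not_eq, pow_lt, Hpos).
      assert (Hdn : is_derive (fun y => INR n * y) y (INR n)) by (auto_derive; [exact I|ring]).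
      generalize (is_derive_comp H (fun y => Theta (INR n * y)) y _ _ (HH _)
        (is_derive_comp Theta (fun y => INR n * y) y _ _
          (flattening_inverse_derive N c Psi Theta _ HF Hpos) Hdn)).
      unfold scal; simpl; unfold mult; simpl.
      replace (INR n * / (c * (1 - cos (Theta (INR n * y))) ^ N) *
        (c * (1 - cos (Theta (INR n * y))) ^ N * (h (Theta (INR n * y)) / INR n)))
        with (h (Theta (INR n * y))) by (field; repeat split; lra || assumption).
      auto. }
  intros y. split; [|apply Hcd].
  destruct (division_cases (INR n * y)) as [z [Hz|Hz]]; [|apply (Hgap y z Hz)].
  (* At a division point the formula is known only on the two neighbouring intervals; 2 pi / n is
     their length. *)
  apply (is_derive_extend (fun y => step n s y * H (Theta (INR n * y)))
    (fun y => step n s y * h (Theta (INR n * y))) y (2 * PI / INR n)).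
  - apply Rdiv_lt_0_compat; lra.
  - apply Hcomp; [exact HHc|]. destruct Hdiv; [left|right; intros; apply H0]; assumption.
  - apply Hcd.
  - intros t Ht Hne. apply Rabs_def2 in Ht.
    assert (E : 2 * PI / INR n * INR n = 2 * PI) by (field; lra).
    destruct Ht as [Ht1 Ht2].
    apply (Rmult_lt_compat_r (INR n)) in Ht1; [|lra]. apply (Rmult_lt_compat_r (INR n)) in Ht2; [|lra].
    destruct (Rlt_le_dec t y) as [Hlt|Hle].
    + apply (Hgap t (z - 1)%Z). apply (Rmult_lt_compat_r (INR n)) in Hlt; [|lra].
      replace (z - 1 + 1)%Z with z by lia. rewrite minus_IZR. lra.
    + apply (Hgap t z). assert (Hlt : y < t) by lra. apply (Rmult_lt_compat_r (INR n)) in Hlt; [|lra].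
      rewrite plus_IZR. lra.
Qed.

Lemma step_field_periodic (n : nat) (Theta H : R -> R) (s : Z -> R) :
  lift Theta -> periodic_2pi H -> (forall z, s (z + Z.of_nat n)%Z = s z) ->
  periodic_2pi (fun y => step n s y * H (Theta (INR n * y))).
Proof.
  intros [_ [_ HT]] HH Hs t. rewrite (step_periodic n s Hs). f_equal.
  rewrite Rmult_plus_distr_l, INR_IZR_INZ, (lift_shift_Z Theta HT).
  apply periodic_shift_Z, HH.
Qed.

(* Multiplied by Psi' = c (1 - cos x)^N, the normal form is transported by theta -> Psi(n theta)/n. *)
Definition flat_W (N : nat) (c x : R) : R := (1 - cos x) * (c * (1 - cos x) ^ N).
Definition flat_V (n N : nat) (c x : R) : R := / INR n * sin x * (c * (1 - cos x) ^ N).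

Lemma flat_W_derive (n N : nat) (c x : R) :
  (1 <= n)%nat ->
  is_derive (flat_W N c) x (c * (1 - cos x) ^ N * ((INR n * INR (S N) * sin x) / INR n)).
Proof.
  intros Hn. assert (Hn0 : 0 < INR n) by (apply lt_0_INR; lia).
  unfold flat_W. auto_derive; [exact I|].
  rewrite S_INR. destruct N as [|N].
  - simpl. field. lra.
  - unfold Rminus. rewrite Nat.pred_succ, <- !tech_pow_Rmult, S_INR. field. lra.
Qed.

(** The identity sin^2 = (1 - cos)(1 + cos) restores the factor 1 - cos lost in differentiating the
    power, so that the derivative of [Psi] still divides the result. *)
Lemma flat_V_derive (n N : nat) (c x : R) :
  (1 <= n)%nat ->
  is_derive (flat_V n N c) x (c * (1 - cos x) ^ N * ((cos x + INR N * (1 + cos x)) / INR n)).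
Proof.
  intros Hn. assert (Hn0 : 0 < INR n) by (apply lt_0_INR; lia).
  unfold flat_V. auto_derive; [exact I|].
  destruct N as [|N].
  - simpl. field. lra.
  - unfold Rminus. rewrite Nat.pred_succ, <- !tech_pow_Rmult.
    assert (Hs : sin x * sin x = (1 - cos x) * (1 + cos x)).
    { pose proof (sin2_cos2 x) as H. unfold Rsqr in H. lra. }
    transitivity (c * / INR n * (1 + - cos x) ^ N * (cos x * (1 + - cos x) + INR (S N) * (sin x * sin x))).
    + rewrite S_INR. field. lra.
    + rewrite Hs. unfold Rminus. field. lra.
Qed.

Definition field_W (n N : nat) (c : R) (Theta : R -> R) (s : Z -> R) (y : R) : R :=
  step n s y * flat_W N c (Theta (INR n * y)).
(** The trivial step 1 gives both fields the same shape, so that [step_field_derive] covers them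
    together. *)
Definition field_V (n N : nat) (c : R) (Theta : R -> R) (y : R) : R :=
  step n (fun _ => 1) y * flat_V n N c (Theta (INR n * y)).

Lemma field_W_derive (n N : nat) (c : R) (Psi Theta : R -> R) (s : Z -> R) (y : R) :
  (1 <= n)%nat -> flattening N c Psi Theta -> (forall z, s z = 1 \/ s z = -1) ->
  is_derive (field_W n N c Theta s) y (step n s y * (INR n * INR (S N) * sin (Theta (INR n * y)))) /\
  continuous (fun y => step n s y * (INR n * INR (S N) * sin (Theta (INR n * y)))) y.
Proof.
  intros Hn HF Hs.
  apply (step_field_derive n N c Psi Theta (flat_W N c) (fun x => INR n * INR (S N) * sin x)); auto.
  - intros x. apply flat_W_derive, Hn.
  - intros x. apply (ex_derive_continuous (fun x => INR n * INR (S N) * sin x)). auto_derive. exact I.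
  - right. intros z. unfold flat_W. rewrite cos_2piZ, sin_2piZ. split; ring.
Qed.

Lemma field_V_derive (n N : nat) (c : R) (Psi Theta : R -> R) (y : R) :
  (1 <= n)%nat -> flattening N c Psi Theta ->
  is_derive (field_V n N c Theta) y
    (1 * (cos (Theta (INR n * y)) + INR N * (1 + cos (Theta (INR n * y))))) /\
  continuous (fun y => 1 * (cos (Theta (INR n * y)) + INR N * (1 + cos (Theta (INR n * y))))) y.
Proof.
  intros Hn HF.
  apply (step_field_derive n N c Psi Theta (flat_V n N c) (fun x => cos x + INR N * (1 + cos x)) (fun _ => 1)); auto.
  - intros x. apply flat_V_derive, Hn.
  - intros x. apply (ex_derive_continuous (fun x => cos x + INR N * (1 + cos x))). auto_derive. exact I.
Qed.

Lemma field_W_vector_field (n N : nat) (c : R) (Psi Theta : R -> R) (s : Z -> R) :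
  (1 <= n)%nat -> flattening N c Psi Theta -> (forall z, s z = 1 \/ s z = -1) ->
  (forall z, s (z + Z.of_nat n)%Z = s z) -> vector_field (field_W n N c Theta s).
Proof.
  intros Hn HF Hs Hper. eapply vector_field_intro.
  - apply (step_field_periodic n Theta (flat_W N c)); [apply HF| |exact Hper].
    intros x. unfold flat_W. rewrite cos_periodic. reflexivity.
  - intros t. apply (field_W_derive n N c Psi Theta s t Hn HF Hs).
  - intros t. apply (field_W_derive n N c Psi Theta s t Hn HF Hs).
Qed.

Lemma field_V_vector_field (n N : nat) (c : R) (Psi Theta : R -> R) :
  (1 <= n)%nat -> flattening N c Psi Theta -> vector_field (field_V n N c Theta).
Proof.
  intros Hn HF. eapply vector_field_intro.
  - apply (step_field_periodic n Theta (flat_V n N c)); [apply HF| |reflexivity].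
    intros x. unfold flat_V. rewrite cos_periodic, sin_periodic. reflexivity.
  - intros t. apply (field_V_derive n N c Psi Theta t Hn HF).
  - intros t. apply (field_V_derive n N c Psi Theta t Hn HF).
Qed.

(** * The normal form as the case N = 0 *)

Lemma normal_W_field (n : nat) (s : Z -> R) (t : R) :
  normal_W n (step n s) t = field_W n 0 1 (fun x => x) s t.
Proof. unfold normal_W, field_W, flat_W. simpl. ring. Qed.

Lemma normal_V_field (n : nat) (t : R) :
  normal_V n (fun _ => 0) t = field_V n 0 1 (fun x => x) t.
Proof. unfold normal_V, field_V, flat_V, step. simpl. ring. Qed.

(** The bracket relation is sin^2 - cos (1 - cos) = 1 - cos, up to the sign. The jumps of the sign
    keep the field C1 because 1 - cos has a double zero at each of them. *)
Lemma normal_affine_pair (n : nat) (s : Z -> R) :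
  (1 <= n)%nat -> (forall z, s z = 1 \/ s z = -1) -> (forall z, s (z + Z.of_nat n)%Z = s z) ->
  affine_pair (normal_W n (step n s)) (normal_V n (fun _ => 0)).
Proof.
  intros Hn Hs Hper. assert (HF := flattening_id). assert (Hn0 : 0 < INR n) by (apply lt_0_INR; lia).
  split; [|split; [split|]].
  - apply (vector_field_ext _ _ (normal_V_field n)), (field_V_vector_field n 0 1 _ _ Hn HF).
  - apply (vector_field_ext _ _ (normal_W_field n s)), (field_W_vector_field n 0 1 _ _ s Hn HF Hs Hper).
  - intros [p [q [Hpq H]]].
    destruct (cos_not_1_on_interval (INR n * p) (INR n * q)) as [t [Ht Hc]]; [nra|].
    specialize (H (t / INR n)). unfold normal_W in H.
    replace (INR n * (t / INR n)) with t in H by (field; lra).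
    assert (Hst : step n s (t / INR n) <> 0) by (unfold step; destruct (Hs (Zfloor (INR n * (t / INR n) / (2 * PI)))) as [-> | ->]; lra).
    assert (p < t / INR n < q).
    { replace p with (INR n * p / INR n) by (field; lra). replace q with (INR n * q / INR n) by (field; lra).
      apply (proj1 (scaled_interval (INR n) _ _ _ Hn0)). replace (INR n * (t / INR n)) with t by (field; lra). exact Ht. }
    apply Rmult_integral in H; [|assumption]. destruct H; [auto|lra].
  - intros t. unfold bracket.
    rewrite (Derive_ext _ _ _ (normal_W_field n s)), (Derive_ext _ _ _ (normal_V_field n)).
    rewrite (is_derive_unique _ _ _ (proj1 (field_W_derive n 0 1 _ _ s t Hn HF Hs))).
    rewrite (is_derive_unique _ _ _ (proj1 (field_V_derive n 0 1 _ _ t Hn HF))).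
    unfold normal_V, normal_W. simpl.
    pose proof (sin2_cos2 (INR n * t)) as H. unfold Rsqr in H.
    transitivity (step n s t * (sin (INR n * t) * sin (INR n * t) - cos (INR n * t) * (1 - cos (INR n * t)))).
    + field. lra.
    + replace (sin (INR n * t) * sin (INR n * t)) with (1 - cos (INR n * t) * cos (INR n * t)) by lra. ring.
Qed.

(** * Transformations of spans; from the intermediate pair to the normal form *)

(** Pushing forward is linear, so generators suffice. The transport formulas are asked at every [t]:
    where [f] fails to be C1 in the application, the fields and their images vanish, so the value of
    [Derive f t] does not matter. *)
Lemma span_transformation (f W V W' V' : R -> R) (L : (R -> R) -> Prop) :
  lift f -> vector_field W' -> vector_field V' ->
  (forall t, W' (f t) = W t * Derive f t) -> (forall t, V' (f t) = V t * Derive f t) ->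
  (forall u, L u <-> span2 W V u) ->
  (exists E : list R, forall t, ~ C1_at f t -> exists e, In e E /\ eq_mod_2pi t e) ->
  (forall t, ~ C1_at f t -> is_lim (Derive f) t p_infty) ->
  equivalence_transformation f L (span2 W' V').
Proof.
  intros Hf HW HV HWf HVf HL HE Hlim.
  assert (Hpush : forall a b, pushes f (fun t => a * W t + b * V t) (fun t => a * W' t + b * V' t)).
  { intros a b. split; [apply vector_field_lin; assumption|].
    intros t _. rewrite HWf, HVf. ring. }
  split; [apply lift_circle_bijection, Hf|]. split; [apply Hf|]. split; [exact HE|].
  split; [auto|]. split.
  - intros w Hw. apply HL in Hw. destruct Hw as [a [b Hw]].
    exists (fun t => a * W' t + b * V' t). split; [exists a, b; reflexivity|].
    destruct (Hpush a b) as [H1 H2]. split; [exact H1|]. intros t Ht. rewrite Hw. apply H2, Ht.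
  - intros w' [a [b Hw']]. exists (fun t => a * W t + b * V t).
    split; [apply HL; exists a, b; reflexivity|].
    destruct (Hpush a b) as [H1 H2]. split; [apply (vector_field_ext _ _ Hw'), H1|].
    intros t Ht. rewrite Hw'. apply H2, Ht.
Qed.

Lemma lift_scale (n : nat) (f : R -> R) :
  (1 <= n)%nat -> lift f -> lift (fun t => f (INR n * t) / INR n).
Proof.
  intros Hn [Hinc [Hc Hp]]. assert (Hn0 : 0 < INR n) by (apply lt_0_INR; lia). split; [|split].
  - intros x y Hxy. apply Rmult_lt_compat_r; [apply Rinv_0_lt_compat, Hn0|].
    apply Hinc, Rmult_lt_compat_l; assumption.
  - intros t. apply (continuous_scal_l (fun t => f (INR n * t)) (/ INR n)).
    apply (continuous_comp (fun t => INR n * t) f); [|apply Hc].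
    apply (is_derive_continuous _ t (INR n)). auto_derive; [exact I|ring].
  - intros t. rewrite Rmult_plus_distr_l, (INR_IZR_INZ n), (lift_shift_Z f Hp), <- INR_IZR_INZ. field. lra.
Qed.

(** Fixing 0, [f] maps each interval between consecutive multiples of 2 pi to itself. *)
Lemma step_conjugate (n : nat) (f : R -> R) (s : Z -> R) (y : R) :
  (1 <= n)%nat -> lift f -> f 0 = 0 -> step n s (f (INR n * y) / INR n) = step n s y.
Proof.
  intros Hn Hf H0. assert (Hn0 : 0 < INR n) by (apply lt_0_INR; lia).
  assert (E : INR n * (f (INR n * y) / INR n) = f (INR n * y)) by (field; lra).
  destruct (division_cases (INR n * y)) as [z [Hz|Hz]].
  - assert (HPI := PI_RGT_0). rewrite !(step_on_gap n s z); rewrite ?E, ?Hz, ?lift_fixes_2piZ; auto; rewrite plus_IZR; lra.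
  - assert (H := lift_preserves_gap f z _ Hf H0 Hz).
    rewrite !(step_on_gap n s z); rewrite ?E; auto; lra.
Qed.

(** With x = Theta(n y), the derivative 1 / (c (1 - cos x)^N) is continuous between division points
    and tends to +oo at them; the latter uses N >= 1. *)
Lemma unflatten_transformation (n N : nat) (c : R) (Psi Theta : R -> R) (s : Z -> R) :
  (1 <= n)%nat -> (1 <= N)%nat -> flattening N c Psi Theta ->
  (forall z, s z = 1 \/ s z = -1) -> (forall z, s (z + Z.of_nat n)%Z = s z) ->
  equivalence_transformation (fun y => Theta (INR n * y) / INR n)
    (span2 (field_W n N c Theta s) (field_V n N c Theta))
    (span2 (normal_W n (step n s)) (normal_V n (fun _ => 0))).
Proof.
  intros Hn HN HF Hs Hper.
  assert (Hn0 : 0 < INR n) by (apply lt_0_INR; lia). assert (HPI := PI_RGT_0).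
  destruct (normal_affine_pair n s Hn Hs Hper) as [HNV [[HNW _] _]].
  destruct (HF) as [Hc [HPsi [HPl [HTl [HTP [HPT HP0]]]]]].
  assert (HT0 := flattening_Theta_0 N c Psi Theta HF).
  set (f := fun y => Theta (INR n * y) / INR n).
  assert (Hfl : lift f) by (apply lift_scale; assumption).
  assert (Hnf : forall y, INR n * f y = Theta (INR n * y)) by (intros y; unfold f; field; lra).
  set (D := fun y => / (c * (1 - cos (Theta (INR n * y))) ^ N)).
  assert (Hpos : forall y z, IZR z * (2 * PI) < INR n * y < IZR (z + 1) * (2 * PI) ->
    0 < 1 - cos (Theta (INR n * y))).
  { intros y z Hz. apply (one_minus_cos_pos z), lift_preserves_gap; assumption. }
  assert (HD : forall y, 0 < 1 - cos (Theta (INR n * y)) -> is_derive f y (D y)).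
  { intros y Hy.
    assert (Hdn : is_derive (fun y => INR n * y) y (INR n)) by (auto_derive; [exact I|ring]).
    generalize (is_derive_scal_l _ y _ (/ INR n) (is_derive_comp Theta (fun y => INR n * y) y _ _
      (flattening_inverse_derive N c Psi Theta _ HF Hy) Hdn)).
    unfold scal; simpl; unfold mult; simpl. fold (D y).
    replace (INR n * D y * / INR n) with (D y) by (field; lra). auto. }
  assert (HTc : forall y, continuous (fun y => 1 - cos (Theta (INR n * y))) y).
  { intros y. apply (continuous_comp (fun y => Theta (INR n * y)) (fun x => 1 - cos x)).
    - apply (continuous_comp (fun y => INR n * y) Theta); [|apply HTl].
      apply (is_derive_continuous _ y (INR n)). auto_derive; [exact I|ring].
    - apply (ex_derive_continuous (fun x => 1 - cos x)). auto_derive. exact I. }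
  assert (Hlocal : forall y z, IZR z * (2 * PI) < INR n * y < IZR (z + 1) * (2 * PI) ->
    locally y (fun t => 0 < 1 - cos (Theta (INR n * t)))).
  { intros y z Hz. apply (locally_open_interval _ (IZR z * (2 * PI) / INR n) (IZR (z + 1) * (2 * PI) / INR n)).
    - apply scaled_interval; assumption.
    - intros t Ht. apply (Hpos t z). apply (scaled_interval _ _ _ _ Hn0) in Ht. exact Ht. }
  assert (HC1 : forall y z, IZR z * (2 * PI) < INR n * y < IZR (z + 1) * (2 * PI) -> C1_at f y).
  { intros y z Hz. assert (HL := Hlocal y z Hz). split.
    - revert HL. apply filter_imp. intros t Ht. exists (D t). apply HD, Ht.
    - apply (continuous_ext_loc _ D).
      + revert HL. apply filter_imp. intros t Ht. symmetry. apply is_derive_unique, HD, Ht.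
      + apply continuous_Rinv_comp.
        * apply (continuous_scal_r c (fun t => (1 - cos (Theta (INR n * t))) ^ N)).
          apply (continuous_comp (fun t => 1 - cos (Theta (INR n * t))) (fun x => x ^ N)); [apply HTc|].
          apply (ex_derive_continuous (fun x => x ^ N)). auto_derive. exact I.
        * apply Rgt_not_eq, Rmult_lt_0_compat; [exact Hc|apply pow_lt, (Hpos y z Hz)]. }
  assert (Hdiv : forall y, ~ C1_at f y -> exists z, INR n * y = IZR z * (2 * PI)).
  { intros y Hy. destruct (division_cases (INR n * y)) as [z [Hz|Hz]]; [exists z; exact Hz|].
    elim Hy. apply (HC1 y z Hz). }
  apply (span_transformation f (field_W n N c Theta s) (field_V n N c Theta)); auto.
  - intros y. unfold normal_W, field_W, flat_W. rewrite Hnf. unfold f. rewrite step_conjugate by assumption. fold f.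
    destruct (division_cases (INR n * y)) as [z [Hz|Hz]].
    + rewrite Hz, (lift_fixes_2piZ Theta z HTl HT0), cos_2piZ. ring.
    + assert (Hp := Hpos y z Hz).
      rewrite (is_derive_unique f y (D y)) by (apply HD, Hp). unfold D.
      assert ((1 - cos (Theta (INR n * y))) ^ N <> 0) by (apply Rgt_not_eq, pow_lt, Hp).
      field. split; [assumption|lra].
  - intros y. unfold normal_V, field_V, flat_V. rewrite Hnf. unfold step.
    destruct (division_cases (INR n * y)) as [z [Hz|Hz]].
    + rewrite Hz, (lift_fixes_2piZ Theta z HTl HT0), cos_2piZ, sin_2piZ. ring.
    + assert (Hp := Hpos y z Hz).
      rewrite (is_derive_unique f y (D y)) by (apply HD, Hp). unfold D.
      assert ((1 - cos (Theta (INR n * y))) ^ N <> 0) by (apply Rgt_not_eq, pow_lt, Hp).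
      field. repeat split; try assumption; lra.
  - tauto.
  (* Reducing the index [z] modulo [n] finds the representative of a division point. *)
  - exists (map (fun k => 2 * PI * INR k / INR n) (seq 0 n)). intros y Hy.
    destruct (Hdiv y Hy) as [z Hz].
    exists (2 * PI * INR (Z.to_nat (z mod Z.of_nat n)) / INR n).
    pose proof (Z.mod_pos_bound z (Z.of_nat n)) as Hb. split.
    + apply (in_map (fun k => 2 * PI * INR k / INR n)). apply in_seq. lia.
    + exists (z / Z.of_nat n)%Z. rewrite INR_IZR_INZ, Z2Nat.id by lia.
      apply (Rmult_eq_reg_l (INR n)); [|lra]. rewrite Hz.
      rewrite (Z.div_mod z (Z.of_nat n)) at 1 by lia.
      rewrite plus_IZR, mult_IZR, <- INR_IZR_INZ. field. lra.
  - intros y Hy. destruct (Hdiv y Hy) as [z Hz].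
    apply (proj1 (is_lim_spec (Derive f) y p_infty)). intros M.
    (* A positive bound can be inverted: the claim becomes c (1 - cos x)^N < 1/M', which is
       continuity at a zero of this function. *)
    set (M' := Rabs M + 1). assert (HM' : 0 < M') by (unfold M'; pose proof (Rabs_pos M); lra).
    assert (Hcont : continuous (fun y => c * (1 - cos (Theta (INR n * y))) ^ N) y).
    { apply (continuous_scal_r c (fun t => (1 - cos (Theta (INR n * t))) ^ N)).
      apply (continuous_comp (fun t => 1 - cos (Theta (INR n * t))) (fun x => x ^ N)); [apply HTc|].
      apply (ex_derive_continuous (fun x => x ^ N)). auto_derive. exact I. }
    destruct (proj1 (continuous_eps _ y) Hcont (/ M')) as [d [Hd Hd']]; [apply Rinv_0_lt_compat, HM'|].
    apply (proj2 (locally_iff (fun t => t <> y -> M < Derive f t) y)).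
    exists (Rmin d (2 * PI / INR n)). split; [apply Rmin_glb_lt; [exact Hd|apply Rdiv_lt_0_compat; lra]|].
    intros t Ht Hne.
    pose proof (Rmin_l d (2 * PI / INR n)). pose proof (Rmin_r d (2 * PI / INR n)).
    assert (Htd : Rabs (t - y) < 2 * PI / INR n) by lra.
    apply Rabs_def2 in Htd. destruct Htd as [Ht1 Ht2].
    apply (Rmult_lt_compat_r (INR n)) in Ht1; [|lra]. apply (Rmult_lt_compat_r (INR n)) in Ht2; [|lra].
    assert (E : 2 * PI / INR n * INR n = 2 * PI) by (field; lra).
    assert (Hp : 0 < 1 - cos (Theta (INR n * t))).
    { destruct (Rlt_le_dec t y) as [Hlt|Hle].
      - apply (Hpos t (z - 1)%Z). replace (z - 1 + 1)%Z with z by lia. rewrite minus_IZR.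
        apply (Rmult_lt_compat_r (INR n)) in Hlt; lra.
      - apply (Hpos t z). assert (Hlt : y < t) by lra. rewrite plus_IZR.
        apply (Rmult_lt_compat_r (INR n)) in Hlt; lra. }
    rewrite (is_derive_unique f t (D t)) by (apply HD, Hp). unfold D.
    assert (Hq : 0 < c * (1 - cos (Theta (INR n * t))) ^ N).
    { apply Rmult_lt_0_compat; [exact Hc|apply pow_lt, Hp]. }
    apply Rlt_le_trans with M'; [unfold M'; pose proof (Rle_abs M); lra|].
    rewrite <- (Rinv_inv M'). apply Rinv_le_contravar; [exact Hq|].
    specialize (Hd' t). rewrite Hz, (lift_fixes_2piZ Theta z HTl HT0), cos_2piZ, Rminus_diag in Hd'.
    rewrite (pow_i N), Rmult_0_r, Rminus_0_r, (Rabs_right (c * _)) in Hd' by (lra || lia).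
    left. apply Hd'. lra.
Qed.

(** * From the given pair to the intermediate pair *)

Lemma zero_enumeration_increasing (W : R -> R) (n : nat) (a : Z -> R) :
  zero_enumeration W n a -> forall z z', (z < z')%Z -> a z < a z'.
Proof.
  intros [_ [Hs _]] z z' H.
  replace z' with (z + 1 + Z.of_nat (Z.to_nat (z' - z - 1)))%Z by lia.
  induction (Z.to_nat (z' - z - 1)) as [|k IH].
  - rewrite Z.add_0_r. apply Hs.
  - apply Rlt_trans with (1 := IH).
    replace (z + 1 + Z.of_nat (S k))%Z with (z + 1 + Z.of_nat k + 1)%Z by lia. apply Hs.
Qed.

Lemma zero_enumeration_index_unique (W : R -> R) (n : nat) (a : Z -> R) (z z' : Z) (t : R) :
  zero_enumeration W n a -> a z <= t < a (z + 1)%Z -> a z' <= t < a (z' + 1)%Z -> z = z'.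
Proof.
  intros Ha H H'.
  assert (Hle : forall x y, (x <= y)%Z -> a x <= a y).
  { intros x y Hxy. destruct (Z.eq_dec x y) as [->|]; [lra|].
    left. apply (zero_enumeration_increasing W n a Ha). lia. }
  destruct (Z.lt_trichotomy z z') as [Hlt|[He|Hlt]]; [|exact He|].
  - specialize (Hle (z + 1)%Z z'). assert (a (z + 1)%Z <= a z') by (apply Hle; lia). lra.
  - specialize (Hle (z' + 1)%Z z). assert (a (z' + 1)%Z <= a z) by (apply Hle; lia). lra.
Qed.

(** The constant [k] precedes [K] because continuity of the density at a zero takes a [K] that
    depends on [k]. *)
Lemma near_zero (W V : R -> R) (a r0 : R) (N : nat) :
  affine_pair W V -> W a = 0 -> 0 < r0 -> (forall t, 0 < Rabs (t - a) < r0 -> W t <> 0) ->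
  (forall t, Derive V t <= INR (2 * N)) ->
  exists k, 0 < k /\ forall K, exists r, 0 < r <= r0 /\ forall t, Rabs (t - a) < r ->
    (a < t -> K * Rabs (W t) < V t /\ k * W t ^ (2 * N) <= Rabs (V t) ^ S (2 * N)) /\
    (t < a -> K * Rabs (W t) < - V t /\ k * W t ^ (2 * N) <= Rabs (V t) ^ S (2 * N)).
Proof.
  intros HP Ha Hr0 Hn HN.
  assert (Hn' : forall e, e = 1 \/ e = -1 -> forall s, 0 < s < r0 -> W (a + e * s) <> 0).
  { intros e He s Hs. apply Hn. replace (a + e * s - a) with (e * s) by ring.
    rewrite Rabs_mult, (Rabs_pm1 e He), Rabs_right; lra. }
  assert (H1 : 1 = 1 \/ 1 = -1) by auto. assert (H2 : -1 = 1 \/ -1 = -1) by auto.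
  destruct (quotient_power_bound W V a 1 r0 N HP Ha H1 Hr0 (Hn' 1 H1) HN) as [k1 [r1 [Hk1 [Hr1 Hb1]]]].
  destruct (quotient_power_bound W V a (-1) r0 N HP Ha H2 Hr0 (Hn' (-1) H2) HN) as [k2 [r2 [Hk2 [Hr2 Hb2]]]].
  exists (Rmin k1 k2). split; [apply Rmin_glb_lt; assumption|]. intros K.
  destruct (quotient_blowup W V a 1 r0 HP Ha H1 Hr0 (Hn' 1 H1) K) as [r3 [Hr3 Hb3]].
  destruct (quotient_blowup W V a (-1) r0 HP Ha H2 Hr0 (Hn' (-1) H2) K) as [r4 [Hr4 Hb4]].
  set (r := Rmin (Rmin r1 r2) (Rmin r3 r4)).
  assert (Hr : 0 < r) by (repeat apply Rmin_glb_lt; lra).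
  assert (r <= r1 /\ r <= r2 /\ r <= r3 /\ r <= r4).
  { pose proof (Rmin_l (Rmin r1 r2) (Rmin r3 r4)). pose proof (Rmin_r (Rmin r1 r2) (Rmin r3 r4)).
    pose proof (Rmin_l r1 r2). pose proof (Rmin_r r1 r2). pose proof (Rmin_l r3 r4). pose proof (Rmin_r r3 r4).
    unfold r. lra. }
  assert (Hev : forall x, 0 <= x ^ (2 * N)) by (intros x; rewrite pow_mult; apply pow_le, pow2_ge_0).
  pose proof (Rmin_l k1 k2). pose proof (Rmin_r k1 k2).
  exists r. split; [lra|]. intros t Ht. apply Rabs_def2 in Ht. specialize (Hev (W t)). split; intros Hat.
  - specialize (Hb1 (t - a)). specialize (Hb3 (t - a)).
    replace (a + 1 * (t - a)) with t in * by ring. split; [lra|].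
    apply Rle_trans with (2 := Hb1 ltac:(lra)). apply Rmult_le_compat_r; lra.
  - specialize (Hb2 (a - t)). specialize (Hb4 (a - t)).
    replace (a + -1 * (a - t)) with t in * by ring. split; [lra|].
    apply Rle_trans with (2 := Hb2 ltac:(lra)). apply Rmult_le_compat_r; lra.
Qed.

(** The argument is x = 2 arccot u, so this is the half-angle formula 1 - cos x = 2 sin^2 (x/2) with
    cot (x/2) = u. *)
Lemma one_minus_cos_arccot (u : R) : 1 - cos (PI - 2 * atan u) = 2 / (1 + u ^ 2).
Proof.
  replace (PI - 2 * atan u) with (PI + - (2 * atan u)) by ring.
  rewrite Rplus_comm, neg_cos, cos_neg, cos_2a_cos, cos_atan.
  assert (H : 0 < 1 + u²) by (pose proof (Rle_0_sqr u); lra).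
  assert (Hs : sqrt (1 + u²) * sqrt (1 + u²) = 1 + u²) by (apply sqrt_sqrt; lra).
  replace (u ^ 2) with (u²) by (unfold Rsqr; ring).
  transitivity (2 / (sqrt (1 + u²) * sqrt (1 + u²))).
  - field. apply Rgt_not_eq, sqrt_lt_R0, H.
  - rewrite Hs. reflexivity.
Qed.

Lemma sin_arccot (u : R) : sin (PI - 2 * atan u) = 2 * u / (1 + u ^ 2).
Proof.
  rewrite sin_PI_x, sin_2a, sin_atan, cos_atan.
  assert (H : 0 < 1 + u²) by (pose proof (Rle_0_sqr u); lra).
  assert (Hs : sqrt (1 + u²) * sqrt (1 + u²) = 1 + u²) by (apply sqrt_sqrt; lra).
  replace (u ^ 2) with (u²) by (unfold Rsqr; ring).
  transitivity (2 * u / (sqrt (1 + u²) * sqrt (1 + u²))).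
  - field. apply Rgt_not_eq, sqrt_lt_R0, H.
  - rewrite Hs. reflexivity.
Qed.

(** Put X = w/v. The last hypothesis says k X^(2N) <= v, and replacing q by v^2 bounds the left side
    by 2^(N+1) X^(2N) X / v. In use w = |W|, v = |V| and q = W^2 + n^2 V^2. *)
Lemma flat_bound (N : nat) (w v k q : R) :
  0 <= w -> 0 < v -> 0 < k -> v ^ 2 <= q -> k * w ^ (2 * N) <= v ^ S (2 * N) ->
  (2 * w ^ 2 / q) ^ N * (2 * w / q) <= 2 ^ S N / k * (w / v).
Proof.
  intros Hw Hv Hk Hq Hb. assert (Hv2 : 0 < v ^ 2) by (apply pow_lt, Hv).
  set (X := w / v). assert (HX : 0 <= X) by (apply Rdiv_le_0_compat; lra).
  assert (Hwv : w = X * v) by (unfold X; field; lra).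
  assert (HkX : k * X ^ (2 * N) <= v).
  { apply (Rmult_le_reg_r (v ^ (2 * N))); [apply pow_lt, Hv|].
    rewrite Rmult_assoc, <- Rpow_mult_distr, <- Hwv, tech_pow_Rmult. exact Hb. }
  assert (HX2 : 0 <= X ^ (2 * N)) by (apply pow_le, HX).
  assert (Hiq : / q <= / v ^ 2) by (apply Rinv_le_contravar; assumption).
  assert (Hiq0 : 0 < / q) by (apply Rinv_0_lt_compat; lra).
  assert (H1 : 0 <= 2 * w ^ 2 / q <= 2 * X ^ 2).
  { split; [apply Rmult_le_pos; [pose proof (pow2_ge_0 w); lra|lra]|].
    apply Rle_trans with (2 * w ^ 2 * / v ^ 2).
    - apply Rmult_le_compat_l; [pose proof (pow2_ge_0 w); lra|exact Hiq].
    - right. unfold X. field. lra. }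
  assert (H2 : 0 <= 2 * w / q <= 2 * X / v).
  { split; [apply Rmult_le_pos; lra|].
    apply Rle_trans with (2 * w * / v ^ 2).
    - apply Rmult_le_compat_l; [lra|exact Hiq].
    - right. unfold X. field. lra. }
  apply Rle_trans with ((2 * X ^ 2) ^ N * (2 * X / v)).
  { apply Rmult_le_compat; try apply H2; [apply pow_le, H1|apply pow_incr, H1]. }
  rewrite Rpow_mult_distr, <- pow_mult.
  replace (2 ^ N * X ^ (2 * N) * (2 * X / v)) with (2 ^ S N * X / (k * v) * (k * X ^ (2 * N)))
    by (simpl pow; field; lra).
  replace (2 ^ S N / k * X) with (2 ^ S N * X / (k * v) * v) by (field; lra).
  apply Rmult_le_compat_l; [|exact HkX].
  apply Rdiv_le_0_compat; [apply Rmult_le_pos; [apply pow_le; lra|exact HX]|apply Rmult_lt_0_compat; assumption].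
Qed.

(* The angle x with V/W = sigma cot(x/2)/n, normalised to increase from 2 pi z to 2 pi (z + 1) along the z-th gap. *)
Lemma exists_angle (W V : R -> R) (n : nat) (a : Z -> R) :
  affine_pair W V -> (1 <= n)%nat -> zero_enumeration W n a ->
  exists x : R -> R,
    (forall z, x (a z) = IZR z * (2 * PI)) /\
    (forall z t, a z < t < a (z + 1)%Z ->
       x t = IZR z * (2 * PI) + (PI - 2 * atan (INR n * (V t / Rabs (W t))))) /\
    (forall t, x (t + 2 * PI) = x t + IZR (Z.of_nat n) * (2 * PI)).
Proof.
  intros HP Hn Ha. destruct (Ha) as [HWa [Has [Hgap [Hper Hcov]]]].
  destruct (HP) as [[HVp _] [[[HWp _] _] _]].
  set (idx := fun t => proj1_sig (constructive_indefinite_description _ (Hcov t))).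
  assert (Hidx : forall t, a (idx t) <= t < a (idx t + 1)%Z).
  { intros t. exact (proj2_sig (constructive_indefinite_description _ (Hcov t))). }
  assert (Huniq : forall z t, a z <= t < a (z + 1)%Z -> idx t = z).
  { intros z t Ht. apply (zero_enumeration_index_unique W n a _ _ t Ha); auto. }
  (* At a zero of W the quotient V/|W| evaluates to 0 and the formula would give PI; the limit 0
     from the right is therefore put in by hand. *)
  exists (fun t => IZR (idx t) * (2 * PI) +
    if Req_EM_T (W t) 0 then 0 else PI - 2 * atan (INR n * (V t / Rabs (W t)))).
  split; [|split].
  - intros z. rewrite (Huniq z) by (specialize (Has z); lra).
    destruct Req_EM_T as [_|Hne]; [ring|]. elim Hne. apply HWa.
  - intros z t Ht. rewrite (Huniq z) by lra.
    destruct Req_EM_T as [He|_]; [|reflexivity]. elim (Hgap z t Ht He).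
  - intros t. rewrite HVp, HWp. rewrite (Huniq (idx t + Z.of_nat n)%Z), plus_IZR.
    + destruct Req_EM_T; ring.
    + replace (idx t + Z.of_nat n + 1)%Z with (idx t + 1 + Z.of_nat n)%Z by lia.
      rewrite !Hper. specialize (Hidx t). lra.
Qed.

Lemma exists_gap_signs (W : R -> R) (n : nat) (a : Z -> R) :
  periodic_2pi W -> (forall t, continuous W t) -> zero_enumeration W n a ->
  exists s : Z -> R, (forall z, s z = 1 \/ s z = -1) /\
    (forall z, s (z + Z.of_nat n)%Z = s z) /\
    (forall z t, a z < t < a (z + 1)%Z -> Rabs (W t) = s z * W t).
Proof.
  intros HWp HWc [_ [Has [Hgap [Hper _]]]].
  set (m := fun z => (a z + a (z + 1)%Z) / 2).
  assert (Hm : forall z, a z < m z < a (z + 1)%Z) by (intros z; specialize (Has z); unfold m; lra).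
  (* The sign is read off at the midpoint of the gap, so that its periodicity in [z] follows from
     that of W. *)
  set (s := fun z => Rabs (W (m z)) / W (m z)).
  assert (Hs : forall z, (s z = 1 \/ s z = -1) /\
    forall t, a z < t < a (z + 1)%Z -> Rabs (W t) = s z * W t).
  { intros z. destruct (constant_sign W (a z) (a (z + 1)%Z) HWc (Hgap z)) as [s' [Hs' H]].
    replace (s z) with s'; [auto|]. unfold s. rewrite (H (m z) (Hm z)). field. apply (Hgap z), Hm. }
  exists s. split; [apply Hs|]. split; [|apply Hs].
  intros z. unfold s. replace (m (z + Z.of_nat n)%Z) with (m z + 2 * PI).
  - rewrite HWp. reflexivity.
  - unfold m. replace (z + Z.of_nat n + 1)%Z with (z + 1 + Z.of_nat n)%Z by lia. rewrite !Hper. field.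
Qed.

(** By atan (1/y) = pi/2 - atan y for y > 0, the angle near [a z] is 2 pi z + 2 atan y on the right
    and 2 pi z - 2 atan y on the left, with y = |W| / (n |V|) -> 0. The left side belongs to gap z -
    1, where the angle has gained a full turn. *)
Lemma angle_continuous_at_zero (W V x : R -> R) (n : nat) (a : Z -> R) (z : Z) :
  affine_pair W V -> (1 <= n)%nat -> zero_enumeration W n a ->
  (forall z, x (a z) = IZR z * (2 * PI)) ->
  (forall z t, a z < t < a (z + 1)%Z ->
     x t = IZR z * (2 * PI) + (PI - 2 * atan (INR n * (V t / Rabs (W t))))) ->
  (forall K, exists r, 0 < r /\ forall t, Rabs (t - a z) < r ->
     (a z < t -> K * Rabs (W t) < V t) /\ (t < a z -> K * Rabs (W t) < - V t)) ->
  continuous x (a z).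
Proof.
  intros HP Hn [_ [Has [Hgap _]]] Hx0 Hx Hnear.
  assert (Hn1 : 1 <= INR n) by (apply (le_INR 1); exact Hn).
  apply continuous_eps. intros eps He.
  assert (Hat : continuous atan 0) by (apply (is_derive_continuous atan 0 _ (is_derive_atan 0))).
  destruct (proj1 (continuous_eps atan 0) Hat (eps / 2)) as [d [Hd Hatan]]; [lra|].
  rewrite atan_0 in Hatan.
  (* With K = 1/d the quotient |W| / (n |V|) is below [d], since n >= 1. *)
  destruct (Hnear (/ d)) as [r [Hr H]].
  set (r' := Rmin r (Rmin (a (z + 1)%Z - a z) (a z - a (z - 1)%Z))).
  assert (Has' := Has (z - 1)%Z). replace (z - 1 + 1)%Z with z in Has' by lia. assert (Has'' := Has z).
  exists r'. split; [repeat apply Rmin_glb_lt; lra|]. intros t Ht.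
  pose proof (Rmin_l r (Rmin (a (z + 1)%Z - a z) (a z - a (z - 1)%Z))).
  pose proof (Rmin_r r (Rmin (a (z + 1)%Z - a z) (a z - a (z - 1)%Z))).
  pose proof (Rmin_l (a (z + 1)%Z - a z) (a z - a (z - 1)%Z)).
  pose proof (Rmin_r (a (z + 1)%Z - a z) (a z - a (z - 1)%Z)).
  assert (Htr : Rabs (t - a z) < r) by (unfold r' in Ht; lra).
  assert (Ht' : Rabs (t - a z) < Rmin (a (z + 1)%Z - a z) (a z - a (z - 1)%Z)) by (unfold r' in Ht; lra).
  apply Rabs_def2 in Ht'. destruct (H t Htr) as [Hright Hleft]. rewrite Hx0.
  assert (Hsmall : forall w v, 0 < w -> / d * w < v -> 0 < w / (INR n * v) < d).
  { intros w v Hw Hwv.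
    assert (Hv : 0 < v) by (apply Rlt_trans with (2 := Hwv), Rmult_lt_0_compat; [apply Rinv_0_lt_compat|]; assumption).
    split; [apply Rdiv_lt_0_compat; [exact Hw|apply Rmult_lt_0_compat; lra]|].
    apply Rlt_div_l; [apply Rmult_lt_0_compat; lra|].
    apply (Rmult_lt_compat_l d) in Hwv; [|exact Hd].
    replace (d * (/ d * w)) with w in Hwv by (field; lra). nra. }
  destruct (Rtotal_order t (a z)) as [Hlt|[->|Hlt]].
  - specialize (Hleft Hlt).
    assert (Hg : a (z - 1)%Z < t < a (z - 1 + 1)%Z) by (replace (z - 1 + 1)%Z with z by lia; lra).
    assert (Hw : 0 < Rabs (W t)) by (apply Rabs_pos_lt, (Hgap _ _ Hg)).
    destruct (Hsmall _ _ Hw Hleft) as [Hp Hpd].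
    assert (Hv : 0 < - V t) by (apply Rlt_trans with (2 := Hleft), Rmult_lt_0_compat; [apply Rinv_0_lt_compat|]; assumption).
    rewrite (Hx _ t Hg).
    replace (INR n * (V t / Rabs (W t))) with (- / (Rabs (W t) / (INR n * - V t))) by (field; lra).
    rewrite atan_opp, atan_inv by exact Hp. rewrite minus_IZR.
    set (y := Rabs (W t) / (INR n * - V t)) in *.
    replace ((IZR z - 1) * (2 * PI) + (PI - 2 * - (PI / 2 - atan y)) - IZR z * (2 * PI)) with (- (2 * (atan y - 0))) by field.
    rewrite Rabs_Ropp, Rabs_mult, (Rabs_right 2) by lra.
    enough (Rabs (atan y - 0) < eps / 2) by lra. apply Hatan. apply Rabs_def1; lra.
  - rewrite Hx0, Rminus_diag, Rabs_R0. exact He.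
  - specialize (Hright Hlt).
    assert (Hg : a z < t < a (z + 1)%Z) by lra.
    assert (Hw : 0 < Rabs (W t)) by (apply Rabs_pos_lt, (Hgap _ _ Hg)).
    destruct (Hsmall _ _ Hw Hright) as [Hp Hpd].
    assert (Hv : 0 < V t) by (apply Rlt_trans with (2 := Hright), Rmult_lt_0_compat; [apply Rinv_0_lt_compat|]; assumption).
    rewrite (Hx _ t Hg).
    replace (INR n * (V t / Rabs (W t))) with (/ (Rabs (W t) / (INR n * V t))) by (field; lra).
    rewrite atan_inv by exact Hp.
    set (y := Rabs (W t) / (INR n * V t)) in *.
    replace (IZR z * (2 * PI) + (PI - 2 * (PI / 2 - atan y)) - IZR z * (2 * PI)) with (2 * (atan y - 0)) by field.
    rewrite Rabs_mult, (Rabs_right 2) by lra.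
    enough (Rabs (atan y - 0) < eps / 2) by lra. apply Hatan. apply Rabs_def1; lra.
Qed.

(* This is the derivative of Psi(x)/n along the angle x of [exists_angle]; the junk value of the quotients makes it 0 at the common zeros of W and V. *)
Definition flat_density (W V : R -> R) (n N : nat) (c t : R) : R :=
  c * ((2 * W t ^ 2 / (W t ^ 2 + INR n ^ 2 * V t ^ 2)) ^ N *
    (2 * Rabs (W t) / (W t ^ 2 + INR n ^ 2 * V t ^ 2))).

Lemma flat_density_zero (W V : R -> R) (n N : nat) (c t : R) :
  W t = 0 -> flat_density W V n N c t = 0.
Proof. intros H. unfold flat_density. rewrite H, Rabs_R0. unfold Rdiv. ring. Qed.

Lemma flat_density_pos (W V : R -> R) (n N : nat) (c t : R) :
  0 < c -> W t <> 0 -> 0 < flat_density W V n N c t.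
Proof.
  intros Hc HW. assert (0 < W t ^ 2) by (apply pow2_gt_0, HW).
  assert (0 <= INR n ^ 2 * V t ^ 2) by (rewrite <- Rpow_mult_distr; apply pow2_ge_0).
  assert (0 < Rabs (W t)) by (apply Rabs_pos_lt, HW).
  unfold flat_density. repeat apply Rmult_lt_0_compat; try lra.
  - apply pow_lt, Rdiv_lt_0_compat; lra.
  - apply Rinv_0_lt_compat. lra.
Qed.

Lemma flat_density_continuous (W V : R -> R) (n N : nat) (c t : R) :
  continuous W t -> continuous V t -> W t <> 0 -> continuous (flat_density W V n N c) t.
Proof.
  intros HW HV Hne.
  assert (Hq : W t ^ 2 + INR n ^ 2 * V t ^ 2 <> 0).
  { assert (0 < W t ^ 2) by (apply pow2_gt_0, Hne).
    assert (0 <= INR n ^ 2 * V t ^ 2) by (rewrite <- Rpow_mult_distr; apply pow2_ge_0). lra. }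
  assert (Hpow : forall k f, continuous f t -> continuous (fun s => f s ^ k) t).
  { intros k f Hf. apply (continuous_comp f (fun y => y ^ k)); [exact Hf|].
    apply (ex_derive_continuous (fun y => y ^ k)). auto_derive. exact I. }
  assert (Hinv : continuous (fun s => / (W s ^ 2 + INR n ^ 2 * V s ^ 2)) t).
  { apply continuous_Rinv_comp; [|exact Hq].
    apply (continuous_plus (fun s => W s ^ 2) (fun s => INR n ^ 2 * V s ^ 2)); [apply Hpow, HW|].
    apply (continuous_scal_r (INR n ^ 2) (fun s => V s ^ 2)), Hpow, HV. }
  apply (continuous_scal_r c (fun s => (2 * W s ^ 2 / (W s ^ 2 + INR n ^ 2 * V s ^ 2)) ^ N *
    (2 * Rabs (W s) / (W s ^ 2 + INR n ^ 2 * V s ^ 2)))).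
  apply (continuous_mult (fun s => (2 * W s ^ 2 / (W s ^ 2 + INR n ^ 2 * V s ^ 2)) ^ N)
    (fun s => 2 * Rabs (W s) / (W s ^ 2 + INR n ^ 2 * V s ^ 2))).
  - apply Hpow. apply (continuous_mult (fun s => 2 * W s ^ 2)); [|exact Hinv].
    apply (continuous_scal_r 2 (fun s => W s ^ 2)), Hpow, HW.
  - apply (continuous_mult (fun s => 2 * Rabs (W s))); [|exact Hinv].
    apply (continuous_scal_r 2 (fun s => Rabs (W s))).
    apply (continuous_comp W Rabs); [exact HW|apply continuous_Rabs].
Qed.

Lemma flat_density_continuous_at_zero (W V : R -> R) (n N : nat) (c k a : R) :
  (1 <= n)%nat -> 0 < c -> 0 < k -> W a = 0 ->
  (forall K, exists r, 0 < r /\ forall t, Rabs (t - a) < r -> t <> a ->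
     K * Rabs (W t) < Rabs (V t) /\ k * W t ^ (2 * N) <= Rabs (V t) ^ S (2 * N)) ->
  continuous (flat_density W V n N c) a.
Proof.
  intros Hn Hc Hk Ha H. apply continuous_eps. intros eps He.
  assert (Hn1 : 1 <= INR n) by (apply (le_INR 1); exact Hn).
  set (B := c * (2 ^ S N / k)).
  assert (HB : 0 < B).
  { apply Rmult_lt_0_compat; [exact Hc|]. apply Rdiv_lt_0_compat; [apply pow_lt; lra|exact Hk]. }
  (* Near [a] the density is at most B |W| / |V|, and K = B/eps makes this less than [eps]. *)
  destruct (H (B / eps)) as [r [Hr Hb]].
  exists r. split; [exact Hr|]. intros t Ht. rewrite (flat_density_zero W V n N c a Ha), Rminus_0_r.
  destruct (Req_dec (W t) 0) as [H0|H0]; [rewrite (flat_density_zero W V n N c t H0), Rabs_R0; exact He|].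
  assert (Hta : t <> a) by (intros ->; auto).
  destruct (Hb t Ht Hta) as [H1 H2].
  rewrite Rabs_right by (apply Rle_ge, Rlt_le, flat_density_pos; assumption).
  assert (Hw : 0 < Rabs (W t)) by (apply Rabs_pos_lt, H0).
  assert (HBe : 0 < B / eps) by (apply Rdiv_lt_0_compat; assumption).
  assert (Hv : 0 < Rabs (V t)) by (apply Rlt_trans with (2 := H1), Rmult_lt_0_compat; assumption).
  assert (HW2 : W t ^ 2 = Rabs (W t) ^ 2) by (rewrite pow2_abs; reflexivity).
  unfold flat_density. rewrite HW2.
  apply Rle_lt_trans with (c * (2 ^ S N / k * (Rabs (W t) / Rabs (V t)))).
  - apply Rmult_le_compat_l; [lra|]. apply flat_bound; try lra.
    + rewrite !pow2_abs. pose proof (pow2_ge_0 (W t)). pose proof (pow2_ge_0 (V t)).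
      assert (1 <= INR n ^ 2) by (apply pow_R1_Rle; exact Hn1). nra.
    + rewrite (pow_mult (Rabs (W t))), pow2_abs, <- pow_mult. exact H2.
  - rewrite <- Rmult_assoc. fold B.
    apply (Rmult_lt_reg_r (Rabs (V t))); [exact Hv|].
    replace (B * (Rabs (W t) / Rabs (V t)) * Rabs (V t)) with (B * Rabs (W t)) by (field; lra).
    apply (Rmult_lt_compat_l eps) in H1; [|exact He].
    replace (eps * (B / eps * Rabs (W t))) with (B * Rabs (W t)) in H1 by (field; lra). exact H1.
Qed.

(** The sign [s] turns the derivative -1/W of V/W into -1/|W|, so the angle increases on every gap
    whatever the sign of W. *)
Lemma angle_gap_derive (W V x : R -> R) (n : nat) (s p q b t : R) :
  affine_pair W V -> (1 <= n)%nat -> (s = 1 \/ s = -1) -> p < t < q ->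
  (forall t, p < t < q -> W t <> 0) -> (forall t, p < t < q -> Rabs (W t) = s * W t) ->
  (forall t, p < t < q -> x t = b + (PI - 2 * atan (INR n * (V t / Rabs (W t))))) ->
  is_derive x t (2 * INR n * Rabs (W t) / (W t ^ 2 + INR n ^ 2 * V t ^ 2)).
Proof.
  intros HP Hn Hs Ht Hne Habs Hx.
  apply (is_derive_ext_loc (fun t => b + (PI - 2 * atan (INR n * s * (V t / W t))))).
  - apply (locally_open_interval _ p q); [exact Ht|]. intros u Hu. rewrite (Hx u Hu), (Habs u Hu).
    replace (INR n * (V u / (s * W u))) with (INR n * s * (V u / W u)); [reflexivity|].
    specialize (Hne u Hu). destruct Hs as [-> | ->]; field; assumption.
  - assert (HWt := Hne t Ht). rewrite (Habs t Ht).
    assert (Hg := quotient_derive W V t HP HWt).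
    set (g := fun u => V u / W u) in Hg.
    change (fun t => b + (PI - 2 * atan (INR n * s * (V t / W t)))) with
      (fun t => b + (PI - 2 * atan (INR n * s * g t))).
    assert (Hq : 0 < W t ^ 2 + INR n ^ 2 * V t ^ 2).
    { assert (0 < W t ^ 2) by (apply pow2_gt_0, HWt).
      assert (0 <= INR n ^ 2 * V t ^ 2) by (rewrite <- Rpow_mult_distr; apply pow2_ge_0). lra. }
    auto_derive.
    + exists (- / W t). exact Hg.
    + change (Derive (fun u : R => g u) t) with (Derive g t).
      rewrite (is_derive_unique g t _ Hg). unfold g.
      destruct Hs as [-> | ->]; field; (split; [|split]) || split; try assumption; try lra; nra.
Qed.

(** The map Psi(x)/n has derivative [flat_density], continuous also at the zeros of W, so its
    exceptional set is empty. On the gaps both transport identities reduce to the expressions of 1 -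
    cos x and sin x through V and W. *)
Lemma flatten_transformation (W V : R -> R) (L : (R -> R) -> Prop) (n N : nat) (a : Z -> R)
    (c : R) (Psi Theta : R -> R) :
  affine_pair W V -> (forall u, L u <-> span2 W V u) -> (1 <= n)%nat -> zero_enumeration W n a ->
  (forall t, Derive V t <= INR (2 * N)) -> flattening N c Psi Theta ->
  exists s f, (forall z, s z = 1 \/ s z = -1) /\ (forall z, s (z + Z.of_nat n)%Z = s z) /\
    equivalence_transformation f L (span2 (field_W n N c Theta s) (field_V n N c Theta)).
Proof.
  intros HP HL Hn Ha HN HF.
  destruct (HP) as [HV [[HW Hint] Hbr]]. destruct (Ha) as [HWa [Has [Hgap [Hper Hcov]]]].
  assert (HWc : forall t, continuous W t) by (intros; apply vector_field_continuous, HW).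
  assert (HVc : forall t, continuous V t) by (intros; apply vector_field_continuous, HV).
  assert (Hn0 : 0 < INR n) by (apply lt_0_INR; lia).
  destruct (HF) as [Hc [HPsi [HPl [HTl [HTP [HPT HP0]]]]]].
  destruct (exists_gap_signs W n a (proj1 HW) HWc Ha) as [s [Hs [Hsper Habs]]].
  destruct (exists_angle W V n a HP Hn Ha) as [x [Hx0 [Hx Hxper]]].
  set (f := fun t => Psi (x t) / INR n).
  exists s, f. split; [exact Hs|]. split; [exact Hsper|].
  set (D := flat_density W V n N c).
  assert (Hnear : forall z, exists k, 0 < k /\ forall K, exists r, 0 < r /\ forall t, Rabs (t - a z) < r ->
    (a z < t -> K * Rabs (W t) < V t /\ k * W t ^ (2 * N) <= Rabs (V t) ^ S (2 * N)) /\
    (t < a z -> K * Rabs (W t) < - V t /\ k * W t ^ (2 * N) <= Rabs (V t) ^ S (2 * N))).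
  { intros z. assert (H1 := Has z). assert (H2 := Has (z - 1)%Z). replace (z - 1 + 1)%Z with z in H2 by lia.
    destruct (near_zero W V (a z) (Rmin (a (z + 1)%Z - a z) (a z - a (z - 1)%Z)) N HP (HWa z)) as [k [Hk H]].
    - apply Rmin_glb_lt; lra.
    - intros t Ht. pose proof (Rmin_l (a (z + 1)%Z - a z) (a z - a (z - 1)%Z)).
      pose proof (Rmin_r (a (z + 1)%Z - a z) (a z - a (z - 1)%Z)).
      destruct Ht as [Ht0 Ht]. apply Rabs_def2 in Ht.
      destruct (Rtotal_order t (a z)) as [Hl|[He|Hl]].
      + apply (Hgap (z - 1)%Z). replace (z - 1 + 1)%Z with z by lia. lra.
      + rewrite He, Rminus_diag, Rabs_R0 in Ht0. lra.
      + apply (Hgap z). lra.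
    - exact HN.
    - exists k. split; [exact Hk|]. intros K. destruct (H K) as [r [Hr Hb]]. exists r. split; [lra|exact Hb]. }
  assert (Hxc : forall z, continuous x (a z)).
  { intros z. apply (angle_continuous_at_zero W V x n a z HP Hn Ha Hx0 Hx).
    destruct (Hnear z) as [k [_ H]]. intros K. destruct (H K) as [r [Hr Hb]].
    exists r. split; [exact Hr|]. intros t Ht. destruct (Hb t Ht) as [H1 H2].
    split; intros Hlt; [apply H1, Hlt|apply H2, Hlt]. }
  assert (HDc : forall t, continuous D t).
  { intros t. destruct (Req_dec (W t) 0) as [H0|H0]; [|apply flat_density_continuous; auto].
    destruct (Hcov t) as [z Hz]. assert (t = a z) as ->.
    { apply NNPP. intros Hne. apply (Hgap z t); [lra|exact H0]. }
    destruct (Hnear z) as [k [Hk H]].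
    apply (flat_density_continuous_at_zero W V n N c k); auto.
    intros K. destruct (H K) as [r [Hr Hb]].
    exists r. split; [exact Hr|]. intros t Ht Hne. destruct (Hb t Ht) as [H1 H2].
    destruct (Rtotal_order t (a z)) as [Hl|[He|Hl]]; [|elim Hne; exact He|].
    - destruct (H2 Hl) as [H3 H4]. split; [|exact H4].
      pose proof (Rle_abs (- V t)) as Hle. rewrite Rabs_Ropp in Hle. lra.
    - destruct (H1 Hl) as [H3 H4]. split; [|exact H4]. pose proof (Rle_abs (V t)). lra. }
  assert (Htrig : forall z t, a z < t < a (z + 1)%Z ->
    1 - cos (x t) = 2 * W t ^ 2 / (W t ^ 2 + INR n ^ 2 * V t ^ 2) /\
    sin (x t) = 2 * INR n * V t * Rabs (W t) / (W t ^ 2 + INR n ^ 2 * V t ^ 2)).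
  { intros z t Ht. rewrite (Hx z t Ht), Rplus_comm, (periodic_shift_Z cos cos_periodic),
      (periodic_shift_Z sin sin_periodic), one_minus_cos_arccot, sin_arccot.
    assert (Hw : 0 < Rabs (W t)) by (apply Rabs_pos_lt, (Hgap z t Ht)).
    rewrite <- (pow2_abs (W t)).
    assert (0 < Rabs (W t) ^ 2) by (apply pow_lt, Hw).
    assert (0 <= INR n ^ 2 * V t ^ 2) by (rewrite <- Rpow_mult_distr; apply pow2_ge_0).
    split; field; lra. }
  assert (Hgd : forall z t, a z < t < a (z + 1)%Z -> is_derive f t (D t)).
  { intros z t Ht.
    assert (Hxd := angle_gap_derive W V x n (s z) _ _ _ t HP Hn (Hs z) Ht (Hgap z) (Habs z) (Hx z)).
    generalize (is_derive_scal_l _ t _ (/ INR n) (is_derive_comp Psi x t _ _ (HPsi (x t)) Hxd)).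
    unfold scal; simpl; unfold mult; simpl.
    rewrite (proj1 (Htrig z t Ht)).
    match goal with |- is_derive _ _ ?u -> _ => replace u with (D t) end; [auto|].
    unfold D, flat_density.
    assert (0 < W t ^ 2) by (apply pow2_gt_0, (Hgap z t Ht)).
    assert (0 <= INR n ^ 2 * V t ^ 2) by (rewrite <- Rpow_mult_distr; apply pow2_ge_0).
    set (y := (2 * W t ^ 2 / (W t ^ 2 + INR n ^ 2 * V t ^ 2)) ^ N). field. split; lra. }
  assert (Hfd : forall t, is_derive f t (D t)).
  { intros t. destruct (Hcov t) as [z Hz]. destruct (Req_dec t (a z)) as [->|Hne].
    2:{ apply (Hgd z). lra. }
    assert (H1 := Has z). assert (H2 := Has (z - 1)%Z). replace (z - 1 + 1)%Z with z in H2 by lia.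
    apply (is_derive_extend f D (a z) (Rmin (a (z + 1)%Z - a z) (a z - a (z - 1)%Z))).
    - apply Rmin_glb_lt; lra.
    - apply (continuous_scal_l (fun t => Psi (x t)) (/ INR n)).
      apply (continuous_comp x Psi); [apply Hxc|apply HPl].
    - apply HDc.
    - intros t Ht Hne. pose proof (Rmin_l (a (z + 1)%Z - a z) (a z - a (z - 1)%Z)).
      pose proof (Rmin_r (a (z + 1)%Z - a z) (a z - a (z - 1)%Z)). apply Rabs_def2 in Ht.
      destruct (Rlt_le_dec t (a z)).
      + apply (Hgd (z - 1)%Z). replace (z - 1 + 1)%Z with z by lia. lra.
      + apply (Hgd z). lra. }
  assert (HC1 : forall t, C1_at f t).
  { intros t. split.
    - apply filter_forall. intros u. exists (D u). apply Hfd.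
    - apply (continuous_ext D); [|apply HDc]. intros u. symmetry. apply is_derive_unique, Hfd. }
  assert (Hfl : lift f).
  { split; [|split].
    - apply (increasing_of_derive f D Hfd).
      + intros t. destruct (Req_dec (W t) 0) as [H0|H0].
        * unfold D. rewrite flat_density_zero by exact H0. lra.
        * left. apply flat_density_pos; assumption.
      (* Strictness comes from W lying in the class: the density vanishes only where W does, and
         these zeros fill no interval. *)
      + intros p q Hpq. apply NNPP. intros Hno. apply Hint. exists p, q. split; [exact Hpq|].
        intros t Ht. apply NNPP. intros H0. apply Hno. exists t. split; [exact Ht|].
        apply Rgt_not_eq, flat_density_pos; assumption.
    - intros t. apply (is_derive_continuous f t (D t)), Hfd.
    - intros t. unfold f. rewrite Hxper, (lift_shift_Z Psi) by apply HPl.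
      rewrite <- INR_IZR_INZ. field. lra. }
  assert (Hnf : forall t, INR n * f t = Psi (x t)) by (intros t; unfold f; field; lra).
  apply (span_transformation f W V).
  - exact Hfl.
  - apply (field_W_vector_field n N c Psi); assumption.
  - apply (field_V_vector_field n N c Psi); assumption.
  - intros t. rewrite (is_derive_unique f t (D t) (Hfd t)).
    unfold field_W. rewrite Hnf, HTP. unfold flat_W.
    destruct (Hcov t) as [z Hz]. destruct (Req_dec t (a z)) as [->|Hne].
    { rewrite Hx0, cos_2piZ, HWa. ring. }
    assert (Ht : a z < t < a (z + 1)%Z) by lra.
    assert (HWt := Hgap z t Ht).
    rewrite (step_on_gap n s z), (proj1 (Htrig z t Ht)).
    + unfold D, flat_density. rewrite (Habs z t Ht).
      set (y := (2 * W t ^ 2 / (W t ^ 2 + INR n ^ 2 * V t ^ 2)) ^ N). unfold Rdiv. ring.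
    (* The image of the z-th gap lies in the z-th interval of the step: the angles at its ends are
       multiples of 2 pi, which [Psi] fixes. *)
    + rewrite Hnf.
      rewrite <- (lift_fixes_2piZ Psi z HPl HP0) at 1. rewrite <- (lift_fixes_2piZ Psi (z + 1) HPl HP0).
      rewrite <- !Hx0, <- !Hnf.
      split; [apply Rlt_le|]; apply Rmult_lt_compat_l; try exact Hn0; apply Hfl; lra.
  - intros t. rewrite (is_derive_unique f t (D t) (Hfd t)).
    unfold field_V. rewrite Hnf, HTP. unfold flat_V, step.
    destruct (Hcov t) as [z Hz]. destruct (Req_dec t (a z)) as [->|Hne].
    { unfold D. rewrite (flat_density_zero W V n N c _ (HWa z)), Hx0, sin_2piZ. ring. }
    assert (Ht : a z < t < a (z + 1)%Z) by lra.
    destruct (Htrig z t Ht) as [-> ->]. unfold D, flat_density.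
    assert (0 < W t ^ 2) by (apply pow2_gt_0, (Hgap z t Ht)).
    assert (0 <= INR n ^ 2 * V t ^ 2) by (rewrite <- Rpow_mult_distr; apply pow2_ge_0).
    set (y := (2 * W t ^ 2 / (W t ^ 2 + INR n ^ 2 * V t ^ 2)) ^ N). field. split; lra.
  - exact HL.
  - exists nil. intros t Ht. elim Ht. apply HC1.
  - intros t Ht. elim Ht. apply HC1.
Qed.

(** * Normal form of an arbitrary realization *)

Theorem theorem1 :
  forall L : (R -> R) -> Prop, realization L ->
  exists (n : nat) (sigma_ lambda_ : nat -> R) (sigma lambda : R -> R),
    (1 <= n)%nat /\
    (forall k : nat, (k < n)%nat -> sigma_ k = 1 \/ sigma_ k = -1) /\
    step_function n sigma_ sigma /\
    step_function n lambda_ lambda /\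
    realization (span2 (normal_W n sigma) (normal_V n lambda)) /\
    equivalent L (span2 (normal_W n sigma) (normal_V n lambda)).
Proof.
  intros L HL.
  destruct (realization_generators L HL) as [W [V [HP HLs]]].
  destruct (exists_zero_enumeration W V HP) as [n [a [Hn Ha]]].
  destruct (HP) as [HV _].
  destruct (bounded_of_periodic (Derive V) (Derive_periodic V HV)
    (fun t => vector_field_continuous_derive V t HV)) as [M HM].
  destruct (INR_unbounded M) as [N HN].
  (* The successor makes the exponent at least 1, as the infinite derivative of [Theta] requires,
     and keeps V' <= 2 (N + 1). *)
  destruct (exists_flattening (S N)) as [c [Psi [Theta HF]]].
  assert (HVN : forall t, Derive V t <= INR (2 * S N)).
  { intros t. specialize (HM t). rewrite mult_INR, (S_INR N). pose proof (pos_INR N). replace (INR 2) with 2 by (simpl; ring). lra. }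
  destruct (flatten_transformation W V L n (S N) a c Psi Theta HP HLs Hn Ha HVN HF) as [s [f [Hs [Hper Hf]]]].
  exists n, (fun k => s (Z.of_nat k)), (fun _ => 0), (step n s), (fun _ => 0).
  split; [exact Hn|]. split; [intros k _; apply Hs|]. split; [|split; [|split]].
  - split; [apply step_periodic, Hper|]. intros k t Hk Ht.
    assert (Hn0 : 0 < INR n) by (apply lt_0_INR; lia).
    apply (scaled_interval (INR n) _ _ t Hn0) in Ht. rewrite !INR_IZR_INZ, Nat2Z.inj_add in Ht.
    apply step_on_gap. rewrite INR_IZR_INZ, !(Rmult_comm _ (2 * PI)).
    change 1%Z with (Z.of_nat 1). lra.
  - split; [intros t; reflexivity|]. intros; reflexivity.
  - apply realization_affine_pair, normal_affine_pair; assumption.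
  - apply t_trans with (span2 (field_W n (S N) c Theta s) (field_V n (S N) c Theta)).
    + apply t_step. exists f. exact Hf.
    + apply t_step. exists (fun y => Theta (INR n * y) / INR n).
      apply (unflatten_transformation n (S N) c Psi); auto. lia.
Qed.
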